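(* For each prime $p$ there exists a family $\{U_i\}_{i\in\mathbb{N}}$ of finite $p$-groups such that $$\lim_{i\to\infty}|U_i|=\infty \quad\text{and}\quad \limsup_{i\to\infty}\frac{|\operatorname{Aut}(U_i)|}{|U_i|^{40/41}}<\infty .$$ In particular, for every prime $p$, there exists a non-abelian finite $p$-group $G$ such that $|\operatorname{Aut}(G)|<|G|$.
   Context: $\operatorname{Aut}(G)$ denotes the group of automorphisms of $G$ and $|G|$ its order. *)

From Stdlib Require Ncring Ncring_tac.
From HB Require Import structures.
From mathcomp Require Import all_boot all_order all_algebra.
From mathcomp Require Import fingroup morphism perm automorphism quotient pgroup.
From mathcomp Require Import cyclic zify ring.
Set Implicit Arguments.
Unset Strict Implicit.
Unset Printing Implicit Defensive.
Import Order.TTheory GRing.Theory Num.Theory.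
Local Open Scope group_scope.
Local Open Scope ring_scope.

(** The groups are congruence subgroups of one algebraic group whose Lie algebra
has fewer derivations than its own dimension.

Let V be the natural two-dimensional module of sl2, let E be free of rank 3, Q
free of rank 2 with three pairwise independent vectors q1, q2, q3 = q1 + q2, and
let L = sl2 + (V * E) + Q (V * E the tensor product) with Q central and
[v * ei, w * ej] = 2 omega(v, w) qi if i = j, and 0 otherwise.  L is perfect of
dimension 3 + 6 + 2 = 11 and its centre Q has dimension 2, so there are 9
dimensions of inner derivations.  Modulo inner ones a derivation kills sl2, so it
acts on V * E through a 3 x 3 matrix on E.  That matrix is diagonal since qi and
qj are independent, and its diagonal entries agree since the map induced on Q has
three pairwise independent eigenvectors.  Only the scaling attached to the
grading (V * E in degree 1, Q in degree 2) is left, and the derivations form a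
space of dimension 10 < 11 (derivation_torsion, in the form valid modulo p^e).

Let U be the group of points over Z/p^e, congruent to 1 modulo p^b, of the
algebraic group of L, with b fixed and e = n + constant.  Then
|U| = p^(11 (e - b)), and it remains to prove that |Aut U| is at most
C p^(10 n) with C independent of n.  Filter Aut U by the subgroups A_s of
automorphisms that are trivial modulo p^(b + s).  Every quotient A_s / A_(s+1)
has bounded order (card_aut_filter_crude), which handles a bounded number of
values of s near both ends.  For the other values, an element phi of A_s has the
first-order term D(x) = p^(e-b-s-r) (phi u - u), where u = 1 + p^b x modulo
p^(2b).  If r <= s, this is a derivation of L killed by p^r (derD, der_br,
der_tors), phi |-> D is additive (derM), and p^(r-1) D = 0 forces phi into
A_(s+1) (der_small).  A derivation is determined, up to torsion of bounded
exponent, by 10 of its coordinates, so A_s modulo a subgroup of A_(s+1) embeds in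
the tenth power of Z/p^e.  As p-th powers of elements of A_s lie in A_(s+1), the
index of A_(s+1) is at most p^10 (card_aut_filter).  Since 10/11 < 40/41, the
bounds on |U| and |Aut U| give both claims.

The group U lives in the units of an associative ring of block matrices, so that
all estimates are congruences in that ring and neither a logarithm nor a
Baker-Campbell-Hausdorff formula enters; this keeps the argument uniform in p,
including p = 2 and p = 3. *)

(** * Congruences modulo powers of p in an additive group or a ring *)

#[local] Instance ncring_ops (A : pzRingType) :
  @Ncring.Ring_ops A 0 1 +%R *%R (fun x y : A => x - y) -%R eq := {}.

#[local] Instance ncring (A : pzRingType) :
  @Ncring.Ring A 0 1 +%R *%R (fun x y => x - y) -%R eq _.
Proof.
split; try exact _; cbn.
all: try (by move=> *; subst).
- by move=> x; exact: add0r.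
- by move=> x y; exact: addrC.
- by move=> x y z; exact: addrA.
- by move=> x; exact: mul1r.
- by move=> x; exact: mulr1.
- by move=> x y z; exact: mulrA.
- by move=> x y z; exact: mulrDl.
- by move=> x y z; exact: mulrDr.
- by move=> x; exact: addrN.
Qed.

Ltac ncring := Ncring_tac.non_commutative_ring.

Section Divisibility.
Variable p : nat.

Definition pdvd (V : zmodType) k (x : V) := exists y, x = y *+ p ^ k.

Section Additive.
Variable V : zmodType.
Implicit Types x y : V.

Lemma pdvd0 k : pdvd k (0 : V).
Proof. by exists 0; rewrite mul0rn. Qed.

Lemma pdvdD k x y : pdvd k x -> pdvd k y -> pdvd k (x + y).
Proof. by move=> [x' ->] [y' ->]; exists (x' + y'); rewrite mulrnDl. Qed.

Lemma pdvdN k x : pdvd k x -> pdvd k (- x).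
Proof. by move=> [x' ->]; exists (- x'); rewrite mulNrn. Qed.

Lemma pdvdB k x y : pdvd k x -> pdvd k y -> pdvd k (x - y).
Proof. by move=> dx dy; apply: pdvdD => //; apply: pdvdN. Qed.

Lemma pdvdBC k x y : pdvd k (x - y) -> pdvd k (y - x).
Proof. by move=> dx; rewrite -opprB; apply: pdvdN. Qed.

Lemma pdvd_trans k x y z : pdvd k (x - y) -> pdvd k (y - z) -> pdvd k (x - z).
Proof. by move=> dx dy; rewrite -[x](subrK y) -addrA; apply: pdvdD. Qed.

Lemma pdvd_join k x y z : pdvd k (x - z) -> pdvd k (y - z) -> pdvd k (x - y).
Proof. by move=> dx dy; apply: pdvd_trans dx (pdvdBC dy). Qed.

Lemma pdvdDr k x y : pdvd k y -> pdvd k (x + y) -> pdvd k x.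
Proof. by move=> dy dxy; rewrite -(addrK y x); apply: pdvdB. Qed.

Lemma pdvd_le k l x : (l <= k)%N -> pdvd k x -> pdvd l x.
Proof.
move=> lk [y ->]; exists (y *+ p ^ (k - l)).
by rewrite -mulrnA -expnD subnK.
Qed.

Lemma pdvdMn k l x : pdvd k x -> pdvd (k + l) (x *+ p ^ l).
Proof. by move=> [y ->]; exists y; rewrite expnD mulrnA. Qed.

Lemma pdvd_mulrn k n x : pdvd k x -> pdvd k (x *+ n).
Proof. by move=> [y ->]; exists (y *+ n); rewrite mulrnAC. Qed.

Lemma pdvd_pow k x : pdvd k (x *+ p ^ k).
Proof. by exists x. Qed.

End Additive.

Section Multiplicative.
Variable A : pzRingType.
Implicit Types x y z : A.

Lemma pdvdM k l x y : pdvd k x -> pdvd l y -> pdvd (k + l) (x * y).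
Proof.
move=> [x' ->] [y' ->]; exists (x' * y').
by rewrite mulrnAl mulrnAr -mulrnA mulnC -expnD.
Qed.

Lemma pdvdMl k x y : pdvd k y -> pdvd k (x * y).
Proof. by move=> [y' ->]; exists (x * y'); rewrite mulrnAr. Qed.

Lemma pdvdMr k x y : pdvd k x -> pdvd k (x * y).
Proof. by move=> [x' ->]; exists (x' * y); rewrite mulrnAl. Qed.

(** For x, y, x', y' near 1, multiplication is addition up to second order. *)
Lemma mul_sub_split x y x' y' :
  x' * y' - x * y =
  (x' - x) + (y' - y) + ((x' - x) * (y' - 1) + (x - 1) * (y' - y)).
Proof. ncring. Qed.

Lemma pdvd_mul_cong n k l k' l' x y x' y' :
  pdvd k (x - x') -> pdvd l y -> pdvd k' x' -> pdvd l' (y - y') ->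
  (n <= k + l)%N -> (n <= k' + l')%N -> pdvd n (x * y - x' * y').
Proof.
move=> dx dy dx' dy' nkl nkl'.
have -> : x * y - x' * y' = (x - x') * y + x' * (y - y') by ncring.
by apply: pdvdD; [apply: pdvd_le nkl _ | apply: pdvd_le nkl' _]; apply: pdvdM.
Qed.

Lemma pdvd_mul1 k x y : pdvd k (x - 1) -> pdvd k (y - 1) -> pdvd k (x * y - 1).
Proof.
move=> dx dy; have ->: x * y - 1 = (x - 1) * y + (y - 1).
  by rewrite mulrBl mul1r addrA subrK.
by apply: pdvdD => //; apply: pdvdMr.
Qed.

Lemma pdvd_exp1 k x n : pdvd k (x - 1) -> pdvd k (x ^+ n - 1).
Proof.
move=> dx; elim: n => [|n IH]; first by rewrite subrr; apply: pdvd0.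
by rewrite exprS; apply: pdvd_mul1.
Qed.

(** In x^n - y^n = sum of x^i (x - y) y^j over i + j = n - 1, the factors x^i and y^j
are 1 modulo p^k, so that each term is x - y modulo p^(m + k). *)
Lemma pdvd_subX m k x y n :
  pdvd m (x - y) -> pdvd k (x - 1) -> pdvd k (y - 1) ->
  pdvd (m + k) (x ^+ n - y ^+ n - (x - y) *+ n).
Proof.
move=> dxy dx dy; elim: n => [|n IH].
  by rewrite !expr0 mulr0n subrr subr0; apply: pdvd0.
rewrite !exprSr mulrSr mul_sub_split.
have -> (a b c f : A) : a + b + c - (f + b) = a - f + c.
  ncring.
apply: pdvdD => //; apply: pdvdD.
  apply: pdvdM => //; rewrite -[_ - _](subrK ((x - y) *+ n)).
  by apply: pdvdD; [exact: pdvd_le (leq_addr _ _) IH | exact: pdvd_mulrn].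
by rewrite addnC; apply: pdvdM => //; apply: pdvd_exp1.
Qed.

(** Raising to the p-th power multiplies a small difference by p and gains one digit:
by the previous lemma the error is of order p^(m + k), with k > rho.  No binomial
coefficient occurs, which is why p = 2 needs no separate treatment. *)
Lemma pdvd_pow_cong k m rho x y z :
  pdvd k (x - 1) -> pdvd k (y - 1) -> (rho < k)%N ->
  pdvd (m + rho) (x - y - z *+ p ^ m) ->
  pdvd (m.+1 + rho) (x ^+ p - y ^+ p - z *+ p ^ m.+1).
Proof.
move=> dx dy rhok dxy; apply: (@pdvd_trans _ _ _ ((x - y) *+ p)).
  apply: (@pdvd_le _ (m + k)); first by rewrite addSnnS leq_add2l.
  apply: pdvd_subX => //; apply: (@pdvdDr _ _ _ (- (z *+ p ^ m))).
    by apply: pdvdN; apply: pdvd_pow.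
  by apply: pdvd_le dxy; rewrite leq_addr.
rewrite addSn -addn1 expnSr mulrnA -mulrnBl -[X in _ *+ X]expn1.
exact: pdvdMn.
Qed.

Lemma pdvd_iter_pow_cong k m rho j x y z :
  pdvd k (x - 1) -> pdvd k (y - 1) -> (rho < k)%N ->
  pdvd (m + rho) (x - y - z *+ p ^ m) ->
  pdvd (m + j + rho) (x ^+ (p ^ j) - y ^+ (p ^ j) - z *+ p ^ (m + j)).
Proof.
move=> dx dy rhok dxy; elim: j => [|j IH]; first by rewrite addn0 !expr1.
rewrite addnS !(expnSr p j) !exprM; apply: (@pdvd_pow_cong k) => //.
- exact: pdvd_exp1.
- exact: pdvd_exp1.
Qed.

End Multiplicative.
End Divisibility.

(** * Two counting lemmas *)

(** With B = f(G), the index of H in G is that of f(H) in B.  As f(H) contains n B,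
this index is at most |B / n B|, which is the order of the n-torsion of B. *)
Lemma card_le_pow_quotient (gT : finGroupType) (G H : {group gT})
    (V : finZmodType) (f : {morphism G >-> V}) n :
  H \subset G -> 'ker f \subset H -> (forall x, x \in G -> (x ^+ n)%g \in H) ->
  (#|G| <= #|[set v : V | v *+ n == 0%R]| * #|H|)%N.
Proof.
move=> sHG sKH powH.
have kerE (A : {group gT}) : 'ker f \subset A -> A \subset G ->
    #|A| = (#|'ker f| * #|f @* A|)%N.
  by move=> sKA sAG; rewrite card_morphim (setIidPr sAG) Lagrange.
rewrite (kerE G) // ?(subset_trans sKH) // (kerE H) // mulnCA leq_mul2l.
apply/orP; right; pose q (v : V) := v *+ n.
have qM : {in [set: V] &, {morph q : x y / (x * y)%g}}.
  by move=> x y _ _; rewrite /q /= FinRing.zmodMgE mulrnDl.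
pose qm := Morphism qM.
rewrite -(LagrangeI (f @* G) ('ker qm)).
have -> : #|(f @* G)%G : 'ker qm| = #|qm @* (f @* G)|.
  by rewrite card_morphim setTI.
rewrite leq_mul //.
  by apply: subset_leq_card; apply/subsetP => v; rewrite !inE => /and3P[].
apply: subset_leq_card; apply/subsetP => _ /morphimP[z _ /morphimP[x Gx _ ->] ->].
have -> : qm (f x) = f (x ^+ n)%g by rewrite morphX.
by apply: mem_morphim; [exact: groupX | exact: powH].
Qed.

Lemma card_le_fibers (T S : finType) (f : T -> S) (B : {set T}) (C : {pred S}) n :
  (forall x, x \in B -> f x \in C) ->
  (forall x, x \in B -> (#|[set y in B | f y == f x]| <= n)%N) ->
  (#|B| <= #|C| * n)%N.
Proof.
move=> fBC fib; rewrite -sum1_card (partition_big f (mem C)) //=.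
rewrite -sum_nat_const leq_sum // => c _.
have [x /andP[/= Bx /eqP <-]|none] := pickP [pred x in B | f x == c].
  apply: leq_trans (fib x Bx); rewrite sum1_card.
  by apply/subset_leq_card/subsetP => y; rewrite !inE.
by rewrite big_pred0.
Qed.

(** * Automorphisms of a group of units that is uniform over a Lie ring *)

Section UniformGroup.
Variables (p e r : nat) (A : finUnitRingType).
Hypothesis p_pr : prime p.
Hypothesis r_gt0 : (0 < r)%N.
Hypothesis expA : forall x : A, x *+ p ^ e = 0.
Hypothesis torsA : forall k (x : A), (k <= e)%N -> x *+ p ^ k = 0 -> pdvd p (e - k) x.

Let b := r.+1.
Implicit Types (u v w : {unit A}) (a : {perm {unit A}}) (x y : A) (k l s : nat).
(** U behaves as the congruence subgroup of level p^b of a group with Lie ring L: an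
element of U that is 1 modulo p^k has a tangent vector in L with quadratic error,
and each vector of L is tangent to U at level b. *)
Variable U : {group {unit A}}.
Variable L : A -> Prop.
Hypothesis U_base : forall u, u \in U -> pdvd p b (val u - 1).
Hypothesis L_D : forall x y, L x -> L y -> L (x + y).
Hypothesis L_Mn : forall x n, L x -> L (x *+ n).
Hypothesis L_br : forall x y, L x -> L y -> L (x * y - y * x).
Hypothesis U_tangent : forall k u, (b <= k)%N -> u \in U -> pdvd p k (val u - 1) ->
  exists2 x, L x & pdvd p (k + k) (val u - 1 - x *+ p ^ k).
Hypothesis U_lift : forall x, L x ->
  exists2 u, u \in U & pdvd p (b + b) (val u - 1 - x *+ p ^ b).

Lemma pdvd_exp0 k (x : A) : (e <= k)%N -> pdvd p k x -> x = 0.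
Proof. by move=> ek [y ->]; rewrite -(subnKC ek) expnD mulrnA expA mul0rn. Qed.

Lemma pdvdP k (x : A) : (k <= e)%N -> reflect (pdvd p k x) (x *+ p ^ (e - k) == 0).
Proof.
move=> ke; apply: (iffP eqP) => [/torsA|[y ->]].
  by rewrite leq_subr subKn //; apply.
by rewrite -mulrnA -expnD subnKC.
Qed.

Lemma pdvd_kill k (x : A) : (k <= e)%N -> pdvd p k x -> x *+ p ^ (e - k) = 0.
Proof. by move=> ke [y ->]; rewrite -mulrnA -expnD subnKC. Qed.

(** The factor p^(e - (b + s)) detects divisibility by p^(b + s) with a boolean test,
because the ring is free over Z/p^e in the sense of torsA. *)
Definition aut_filter s : {set {perm {unit A}}} :=
  [set a in Aut U |
    [forall u in U, (val (a u) - val u) *+ p ^ (e - (b + s)) == 0]].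

Lemma in_aut_filter s a :
  (b + s <= e)%N ->
  (a \in aut_filter s) <->
  (a \in Aut U /\ forall u, u \in U -> pdvd p (b + s) (val (a u) - val u)).
Proof.
move=> bs; rewrite inE; split=> [/andP[-> /'forall_implyP aU]|[-> aU]].
  by split=> // u uU; apply/(pdvdP _ bs)/aU.
by apply/'forall_implyP => u uU; apply/(pdvdP _ bs)/aU.
Qed.

Lemma autM a u v : a \in Aut U -> u \in U -> v \in U -> a (u * v)%g = (a u * a v)%g.
Proof. by move=> /Aut_morphic/morphicP; apply. Qed.

Lemma aut1 a : a \in Aut U -> a 1%g = 1%g.
Proof. by move=> aU; rewrite -(autmE aU) morph1. Qed.

Lemma autX a u n : a \in Aut U -> u \in U -> a (u ^+ n)%g = (a u ^+ n)%g.
Proof. by move=> aU uU; rewrite -(autmE aU) morphX. Qed.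

Lemma aut_filter_group_set s : group_set (aut_filter s).
Proof.
apply/group_setP; split.
  rewrite inE group1; apply/'forall_implyP => u _.
  by rewrite perm1 subrr mul0rn.
move=> a c; rewrite inE => /andP[aU /'forall_implyP ha].
rewrite inE => /andP[cU /'forall_implyP hc].
rewrite inE groupM //; apply/'forall_implyP => u uU.
rewrite permM -(subrK (val (a u)) (val (c _))) -addrA mulrnDl.
by rewrite (eqP (ha u uU)) (eqP (hc _ (Aut_closed aU uU))) addr0.
Qed.
Canonical aut_filter_group s := group (aut_filter_group_set s).

Lemma val_coset k u v : pdvd p k (val u - val v) -> pdvd p k (val (v^-1 * u)%g - 1).
Proof.
move=> d; rewrite FinRing.val_unitM.
have -> : val v^-1%g * val u - 1 = val v^-1%g * (val u - val v).
  by rewrite mulrBr -!FinRing.val_unitM mulVg.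
exact: pdvdMl.
Qed.

(** The displacement a u - u hardly changes when u is multiplied by an element v that
a moves little: a (u v) - u v = (a u - u) (a v) + u (a v - v). *)
Lemma pdvd_aut_sub a u w k l :
  a \in Aut U -> u \in U -> w \in U -> (l <= k + b)%N ->
  pdvd p k (val (a u) - val u) ->
  pdvd p l (val (a (u^-1 * w)%g) - val (u^-1 * w)%g) ->
  pdvd p l (val (a w) - val w - (val (a u) - val u)).
Proof.
move=> aU uU wU lkb du dv; set v := (u^-1 * w)%g in dv *.
have vU : v \in U by rewrite groupM ?groupV.
have -> : w = (u * v)%g by rewrite mulKVg.
rewrite autM // !FinRing.val_unitM.
have -> : val (a u) * val (a v) - val u * val v - (val (a u) - val u) =
   (val (a u) - val u) * (val (a v) - 1) + val u * (val (a v) - val v).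
  move: (val _) (val _) (val u) (val v) => a1 a2 a3 a4; ncring.
apply: pdvdD; last exact: pdvdMl.
by apply: pdvd_le lkb _; apply: pdvdM => //; apply/U_base/Aut_closed.
Qed.

Lemma pdvd_aut_base a u : a \in Aut U -> u \in U -> pdvd p b (val (a u) - val u).
Proof.
move=> aU uU; apply: (@pdvd_trans _ _ _ _ 1); first exact/U_base/Aut_closed.
exact/pdvdBC/U_base.
Qed.

(** An automorphism close to the identity is even closer on deeper elements.  An
element of level k agrees to one more digit with a p^(k-b)-th power of an element
of U, where the claim comes from pdvd_iter_pow_cong; the quotient is of level
k + 1, whence a descending induction on k. *)
Lemma aut_filter_level s a k u :
  a \in aut_filter s -> (b + s <= e)%N -> u \in U -> (b <= k)%N ->
  pdvd p k (val u - 1) -> pdvd p (k + s) (val (a u) - val u).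
Proof.
move=> + bs; move=> /(in_aut_filter _ bs) [aU ha] uU.
have [n] := ubnPleq (e - k); elim: n k u uU => [|n IH] k u uU ekn bk du.
  have/pdvd_exp0 : (e <= k)%N by rewrite -subn_eq0 -leqn0.
  move=> /(_ _ du)/eqP; rewrite subr_eq0 => /eqP u1.
  have -> : u = 1%g by apply: val_inj.
  by rewrite aut1 // subrr; apply: pdvd0.
have [x Lx dx] := U_tangent bk uU du; have [u0 u0U du0] := U_lift Lx.
pose v := (u0 ^+ (p ^ (k - b)))%g.
have vU : v \in U by rewrite groupX.
have b1 : (1 < b)%N by rewrite ltnS.
have dv : pdvd p k.+1 (val u - val v).
  apply: (@pdvd_join _ _ _ _ _ (1 + x *+ p ^ k)); rewrite opprD addrA.
    by apply: pdvd_le dx; rewrite -addn1 leq_add2l (leq_trans _ bk).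
  rewrite FinRing.val_unitX -addn1.
  have := @pdvd_iter_pow_cong p A b b 1 (k - b) (val u0) 1 x.
  rewrite expr1n subnKC //; apply=> //; first exact: U_base.
    by rewrite subrr; apply: pdvd0.
  by apply: pdvd_le du0; rewrite leq_add2l ltnW.
have dav : pdvd p (k + s) (val (a v) - val v).
  have [y ay] := ha _ u0U.
  have := @pdvd_iter_pow_cong p A b (b + s) 0 (k - b) (val (a u0)) (val u0) y.
  rewrite !addn0 ay subrr autX // !FinRing.val_unitX (addnAC b s) subnKC // => H.
  apply: (@pdvdDr _ _ _ _ (- (y *+ p ^ (k + s)))); first exact/pdvdN/pdvd_pow.
  by apply: H => //; [exact/U_base/Aut_closed | exact/U_base | exact: pdvd0].
have daw : pdvd p (k + s) (val (a (v^-1 * u)%g) - val (v^-1 * u)%g).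
  apply: (@pdvd_le _ _ (k.+1 + s)); first by rewrite leq_add2r.
  apply: IH; rewrite ?groupM ?groupV //; last exact: val_coset.
  - by rewrite subnS -subn1 leq_subLR add1n.
  - exact: leqW.
rewrite -(subrK (val (a v) - val v) (val (a u) - val u)); apply: pdvdD => //.
by apply: (@pdvd_aut_sub _ _ _ (k + s)) => //; rewrite leq_addr.
Qed.

(** If w and u^(p^j) have the same tangent vector, they are displaced in the same
way, and the displacement of u^(p^j) is p^j times that of u.  This makes the
first-order term of an automorphism depend on the tangent vector alone, and
compares its values at levels b and b + j. *)
Lemma aut_lift_cong a s rho j w u x :
  a \in aut_filter s -> (b + s <= e)%N -> (rho <= r)%N -> u \in U -> w \in U ->
  pdvd p (b + b) (val u - 1 - x *+ p ^ b) ->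
  pdvd p (b + j + rho) (val w - 1 - x *+ p ^ (b + j)) ->
  pdvd p (b + j + s + rho) (val (a w) - val w - (val (a u) - val u) *+ p ^ j).
Proof.
move=> as_ bs rhor uU wU du dw; have [aU ha] := (in_aut_filter a bs).1 as_.
pose v := (u ^+ (p ^ j))%g; have vU : v \in U by rewrite groupX.
have dv : pdvd p (b + j + rho) (val v - 1 - x *+ p ^ (b + j)).
  rewrite FinRing.val_unitX; have := @pdvd_iter_pow_cong p A b b rho j (val u) 1 x.
  rewrite expr1n; apply=> //; first exact: U_base.
    by rewrite subrr; apply: pdvd0.
  by apply: pdvd_le du; rewrite leq_add2l leqW.
have dwv : pdvd p (b + j + rho) (val w - val v).
  by apply: (@pdvd_join _ _ _ _ _ (1 + x *+ p ^ (b + j))); rewrite opprD addrA.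
have [y ay] := ha _ uU.
have dav : pdvd p (b + j + s + rho) (val (a v) - val v - (val (a u) - val u) *+ p ^ j).
  have := @pdvd_iter_pow_cong p A b (b + s) rho j (val (a u)) (val u) y.
  rewrite ay subrr autX // !FinRing.val_unitX (addnAC b s) -mulrnA -expnD (addnAC b s).
  by apply=> //; [exact/U_base/Aut_closed | exact/U_base | exact: pdvd0].
apply: pdvd_trans dav; apply: (@pdvd_aut_sub _ _ _ (b + j + s)) => //.
- by rewrite leq_add2l leqW.
- apply: aut_filter_level => //; first by rewrite leq_addr.
  apply: (@pdvdDr _ _ _ _ (- (x *+ p ^ (b + j)))); first exact/pdvdN/pdvd_pow.
  by apply: pdvd_le dv; rewrite leq_addr.
- rewrite addnAC; apply: aut_filter_level => //.
  + by rewrite groupM ?groupV.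
  + by rewrite -addnA leq_addr.
  + exact: val_coset.
Qed.

(** The group commutator is tangent to the Lie bracket: with g and h the values of u
and v, w - 1 differs from [g - 1, h - 1] by a factor near 1. *)
Lemma commutator_cong u v x y : u \in U -> v \in U ->
  pdvd p (b + b) (val u - 1 - x *+ p ^ b) ->
  pdvd p (b + b) (val v - 1 - y *+ p ^ b) ->
  let w := (u * v * (v * u)^-1)%g in
  pdvd p (b + b + b) (val w - 1 - (x * y - y * x) *+ p ^ (b + b)).
Proof.
move=> uU vU du dv w; set g := val u in du *; set h := val v in dv *.
have wE : val w * (h * g) = g * h by rewrite -!FinRing.val_unitM mulgKV.
have dg : pdvd p b (g - 1) by apply: U_base.
have dh : pdvd p b (h - 1) by apply: U_base.
have brE : val w * (h * g) - h * g = (g - 1) * (h - 1) - (h - 1) * (g - 1).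
  by rewrite wE; ncring.
have dw : pdvd p (b + b) (val w - 1).
  have -> : val w - 1 = (val w * (h * g) - h * g) * val (v * u)^-1%g.
    have -> : h * g = val (v * u)%g by [].
    rewrite mulrBl -mulrA -FinRing.val_unitM mulgV mulr1.
    by [].
  by rewrite brE; apply/pdvdMr/pdvdB; apply: pdvdM.
have -> : val w - 1 - (x * y - y * x) *+ p ^ (b + b) =
  (val w - 1) * (1 - h * g)
   + ((g - 1) * (h - 1) - x *+ p ^ b * (y *+ p ^ b)
      - ((h - 1) * (g - 1) - y *+ p ^ b * (x *+ p ^ b))).
  have -> : (x * y - y * x) *+ p ^ (b + b) =
     x *+ p ^ b * (y *+ p ^ b) - y *+ p ^ b * (x *+ p ^ b).
    by rewrite !(mulrnAl, mulrnAr) -!mulrnA -expnD -mulrnBl.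
  have acc (a1 a2 c1 c2 : A) : a1 - c1 - (a2 - c2) = a1 - a2 - (c1 - c2) by ncring.
  rewrite (acc ((g - 1) * (h - 1))) -brE; move: (_ *+ _ * _ - _) => c; ncring.
apply: pdvdD.
  by apply: pdvdM => //; apply: pdvdBC; apply: pdvd_mul1.
by apply: pdvdB; apply: (@pdvd_mul_cong _ _ _ (b + b) b b (b + b));
   rewrite ?addnA //; apply: pdvd_pow.
Qed.

Lemma U_pgroup : p.-group U.
Proof.
apply/pgroupP => q q_pr /(Cauchy q_pr)[u uU uq]; have: (q %| p ^ e)%N.
  rewrite -uq order_dvdn; apply/eqP/val_inj; rewrite FinRing.val_unitX.
  apply/eqP; rewrite -subr_eq0; apply/eqP/(@pdvd_exp0 (b + e)); first exact: leq_addl.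
  have [y uE] := U_base uU; have H := @pdvd_iter_pow_cong p A b b 0 e (val u) 1 y.
  apply: (@pdvdDr _ _ _ _ (- (y *+ p ^ (b + e)))); first exact/pdvdN/pdvd_pow.
  rewrite expr1n !addn0 in H; apply: H => //; first exact: U_base.
    by rewrite subrr; apply: pdvd0.
  by rewrite uE subrr; apply: pdvd0.
rewrite Euclid_dvdX // => /andP[+ _].
by rewrite dvdn_prime2 // => /eqP ->; rewrite inE.
Qed.

(** The m values coord j (D (probe j)) determine a derivation D of L that is killed
by p^r, up to an error killed by p^(r-1).  Over a field this would say that the
derivations have dimension at most m. *)
Variables (m : nat) (V : finZmodType).
Variables (probe : 'I_m -> A) (coord : 'I_m -> A -> V).
Hypothesis coordD : forall j x y, coord j (x + y) = coord j x + coord j y.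
Hypothesis L_probe : forall j, L (probe j).
Hypothesis V_tors : (#|[set v : V | v *+ p == 0%R]| <= p)%N.
Hypothesis probeP : forall D : A -> A,
  (forall x, L x -> L (D x)) ->
  (forall x y, L x -> L y -> D (x + y) = D x + D y) ->
  (forall x y, L x -> L y ->
     D (x * y - y * x) = D x * y - y * D x + (x * D y - D y * x)) ->
  (forall x, L x -> D x *+ p ^ r = 0) ->
  (forall j, coord j (D (probe j)) = 0) ->
  forall x, L x -> D x *+ p ^ r.-1 = 0.

Section Derivation.
Variable s : nat.
Hypothesis rs : (r <= s)%N.
Hypothesis bsr : (b + b + s + r <= e)%N.

Let bs : (b + s <= e)%N.
Proof. by lia. Qed.

Lemma aut_tangent a u : a \in aut_filter s -> u \in U ->
  exists2 y, L y & pdvd p (b + s + r) (val (a u) - val u - y *+ p ^ (b + s)).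
Proof.
move=> as_ uU; have [aU ha] := (in_aut_filter a bs).1 as_.
have auU := Aut_closed aU uU; have [y Ly dy] : exists2 y, L y &
    pdvd p (b + s + (b + s)) (val (u^-1 * a u)%g - 1 - y *+ p ^ (b + s)).
  apply: U_tangent; rewrite ?leq_addr // ?groupM ?groupV //.
  exact/val_coset/ha.
exists y => //.
have -> : val (a u) - val u - y *+ p ^ (b + s) =
  val u * (val (u^-1 * a u)%g - 1 - y *+ p ^ (b + s)) + (val u - 1) * y *+ p ^ (b + s).
  rewrite -mulrnAr !mulrBr mulr1 mulrBl mul1r -FinRing.val_unitM mulKVg.
  by rewrite addrA subrK.
apply: pdvdD.
  by apply: pdvdMl; apply: pdvd_le dy; lia.
apply: (@pdvd_le _ _ (b + (b + s))); last by apply/pdvdMn/pdvdMr/U_base.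
by rewrite addnC leq_add2r.
Qed.

(** First-order Leibniz rule for a product of group elements, both near 1. *)
Lemma aut_additive a u v : a \in aut_filter s -> u \in U -> v \in U ->
  pdvd p (b + s + r) (val (a (u * v)%g) - val (u * v)%g
     - ((val (a u) - val u) + (val (a v) - val v))).
Proof.
move=> as_ uU vU; have [aU ha] := (in_aut_filter a bs).1 as_.
rewrite autM // !FinRing.val_unitM mul_sub_split addrAC subrr add0r.
apply: (@pdvd_le _ _ (b + s + b)); first by rewrite leq_add2l.
apply: pdvdD; first by apply: pdvdM; [exact: ha | exact/U_base/Aut_closed].
by rewrite addnC; apply: pdvdM; [exact: U_base | exact: ha].
Qed.

(** Linearizing w (v u) = u v and its image under a gives the derivation rule for
the displacement of a commutator.  Replacing a v - 1 by p^b y costs the error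
a v - v, of order p^(b+s); this is where r <= s is used. *)
Lemma aut_commutator a u v x y : a \in aut_filter s -> u \in U -> v \in U ->
  pdvd p (b + b) (val u - 1 - x *+ p ^ b) ->
  pdvd p (b + b) (val v - 1 - y *+ p ^ b) ->
  let w := (u * v * (v * u)^-1)%g in
  let d u := val (a u) - val u in
  pdvd p (b + b + s + r)
    (d w - (d u * y - y * d u + (x * d v - d v * x)) *+ p ^ b).
Proof.
move=> as_ uU vU du dv w d; have [aU ha] := (in_aut_filter a bs).1 as_.
have wU : w \in U by rewrite groupM ?groupV ?groupM.
have dw := @pdvd_le _ _ _ (b + b) _ (leq_addr _ _) (commutator_cong uU vU du dv).
have {}dw : pdvd p (b + b) (val w - 1).
  exact: (@pdvdDr _ _ _ _ _ (pdvdN (pdvd_pow _ _ _)) dw).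
have daw : pdvd p (b + b + s) (d w) by apply: aut_filter_level => //; clear; lia.
have [au av] := (Aut_closed aU uU, Aut_closed aU vU).
have [dau dav] := (U_base au, U_base av).
have [dgu dgv] := (ha _ uU, ha _ vU).
have wE : val w * (val v * val u) = val u * val v.
  by rewrite -!FinRing.val_unitM mulgKV.
have awE : val (a w) * (val (a v) * val (a u)) = val (a u) * val (a v).
  have vuU : (v * u)%g \in U by rewrite groupM.
  by rewrite -!FinRing.val_unitM -(autM aU) // -(autM aU) // -(autM aU) // mulgKV.
have -> : (d u * y - y * d u + (x * d v - d v * x)) *+ p ^ b =
   d u * (y *+ p ^ b) - y *+ p ^ b * d u + (x *+ p ^ b * d v - d v * (x *+ p ^ b)).
  by rewrite mulrnDl !mulrnBl !(mulrnAl, mulrnAr).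
set x' := x *+ _ in du *; set y' := y *+ _ in dv *.
have -> : d w = d w * (1 - val (a v) * val (a u))
   - (val w - 1) * (val (a v) * val (a u) - val v * val u)
   + ((val (a w) * (val (a v) * val (a u)) - val (a v) * val (a u))
     - (val w * (val v * val u) - val v * val u)).
  rewrite /d; move: (val (a w)) (val (a v)) (val (a u)) (val w) (val v) (val u).
  by move=> *; ncring.
rewrite {}awE {}wE.
have -> : val (a u) * val (a v) - val (a v) * val (a u) - (val u * val v - val v * val u)
  = d u * (val (a v) - 1) - (val (a v) - 1) * d u
   + ((val u - 1) * d v - d v * (val u - 1)).
  rewrite /d; move: (val (a v)) (val (a u)) (val v) (val u).
  by move=> *; ncring.
rewrite -addrA; apply: pdvdD.
  apply: pdvdB.
    apply: (@pdvd_le _ _ (b + b + s + b)); first by clear - rs bsr; lia.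
    by apply: pdvdM => //; apply/pdvdBC/pdvd_mul1.
  apply: (@pdvd_le _ _ (b + b + (b + s))); first by clear - rs bsr; lia.
  apply: pdvdM => //.
  apply: (@pdvd_mul_cong _ _ _ (b + s) 0 0 (b + s)) => //; try by clear; lia.
  - by exists (val (a u)); rewrite mulr1n.
  - by exists (val v); rewrite mulr1n.
have dav' : pdvd p (b + r) (val (a v) - 1 - y').
  rewrite (_ : _ - _ = d v + (val v - 1 - y')); last by rewrite !addrA subrK.
  by apply: pdvdD; [apply: pdvd_le dgv | apply: pdvd_le dv]; clear - rs; lia.
have -> (a1 a2 a3 a4 c1 c2 c3 c4 : A) :
  a1 - a2 + (a3 - a4) - (c1 - c2 + (c3 - c4)) =
  a1 - c1 - (a2 - c2) + (a3 - c3 - (a4 - c4)) by ncring.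
apply: pdvdD; apply: pdvdB.
- rewrite -mulrBr; apply: (@pdvd_le _ _ (b + s + (b + r))); first by clear - rs bsr; lia.
  exact: pdvdM.
- rewrite -mulrBl; apply: (@pdvd_le _ _ (b + r + (b + s))); first by clear - rs bsr; lia.
  exact: pdvdM.
- rewrite -mulrBl; apply: (@pdvd_le _ _ (b + b + (b + s))); first by clear - rs bsr; lia.
  exact: pdvdM.
- rewrite -mulrBr; apply: (@pdvd_le _ _ (b + s + (b + b))); first by clear - rs bsr; lia.
  exact: pdvdM.
Qed.

Definition unit_lift x : {unit A} :=
  odflt 1%g [pick u in U | (val u - 1 - x *+ p ^ b) *+ p ^ (e - (b + b)) == 0].

Lemma unit_liftP x : L x ->
  unit_lift x \in U /\ pdvd p (b + b) (val (unit_lift x) - 1 - x *+ p ^ b).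
Proof.
have bb : (b + b <= e)%N by clear - bsr; lia.
move=> Lx; rewrite /unit_lift; case: pickP => [u /andP[uU /(pdvdP _ bb)]//|none].
have [u uU du] := U_lift Lx; have /negP[] := negbT (none u).
by rewrite /= uU; apply/(pdvdP _ bb).
Qed.

(** The first-order term of a, for a in aut_filter s.  The displacement is divisible
by p^(b+s) and matters modulo p^(b+s+r); multiplication by p^(e-(b+s+r)) encodes
this residue class as a p^r-torsion element, on which identities are exact. *)
Definition der a x := (val (a (unit_lift x)) - val (unit_lift x)) *+ p ^ (e - (b + s + r)).

Let bsr' : (b + s + r <= e)%N.
Proof. by clear - bsr; lia. Qed.

Lemma der_unit a u x : a \in aut_filter s -> u \in U -> L x ->
  pdvd p (b + r) (val u - 1 - x *+ p ^ b) ->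
  (val (a u) - val u) *+ p ^ (e - (b + s + r)) = der a x.
Proof.
move=> as_ uU Lx du; have [vU dv] := unit_liftP Lx.
have := @aut_lift_cong a s r 0 u (unit_lift x) x as_ bs (leqnn r) vU uU dv.
rewrite addn0 => /(_ du); rewrite mulr1n => /(pdvd_kill bsr')/eqP.
by rewrite mulrnBl subr_eq0 => /eqP.
Qed.

Lemma derD a x y : a \in aut_filter s -> L x -> L y ->
  der a (x + y) = der a x + der a y.
Proof.
move=> as_ Lx Ly; have [[uU du] [vU dv]] := (unit_liftP Lx, unit_liftP Ly).
rewrite -(@der_unit a (unit_lift x * unit_lift y)%g) ?groupM //; last 2 first.
- exact: L_D.
- rewrite FinRing.val_unitM.
  have -> : val (unit_lift x) * val (unit_lift y) - 1 - (x + y) *+ p ^ b =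
    (val (unit_lift x) - 1 - x *+ p ^ b) + (val (unit_lift y) - 1 - y *+ p ^ b)
      + (val (unit_lift x) - 1) * (val (unit_lift y) - 1).
    rewrite mulrnDl; move: (val _) (val _) (x *+ _) (y *+ _) => *; ncring.
  apply: (@pdvd_le _ _ (b + b)); first by clear; lia.
  by apply: pdvdD; [exact: pdvdD | apply: pdvdM; exact: U_base].
have /(pdvd_kill bsr')/eqP := aut_additive as_ uU vU.
by rewrite mulrnBl subr_eq0 => /eqP ->; rewrite mulrnDl.
Qed.

(** The unit lifting [x, y] has the same tangent vector as the commutator of the
lifts of x and y, but at level b and not 2b: aut_lift_cong with j = b compares
the two displacements. *)
Lemma der_br a x y : a \in aut_filter s -> L x -> L y ->
  der a (x * y - y * x) = der a x * y - y * der a x + (x * der a y - der a y * x).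
Proof.
move=> as_ Lx Ly; have [[uU du] [vU dv]] := (unit_liftP Lx, unit_liftP Ly).
have [wU dw] := unit_liftP (L_br Lx Ly).
have cU : (unit_lift x * unit_lift y * (unit_lift y * unit_lift x)^-1)%g \in U.
  by rewrite groupM ?groupV ?groupM.
have powE (z : A) : z *+ p ^ b *+ p ^ (e - (b + b + s + r)) = z *+ p ^ (e - (b + s + r)).
  by rewrite -mulrnA -expnD; congr (_ *+ p ^ _); clear - bsr; lia.
have /(pdvd_kill bsr)/eqP := aut_commutator as_ uU vU du dv.
rewrite mulrnBl subr_eq0 powE => /eqP commE.
have := @aut_lift_cong a s r b _ _ _ as_ bs (leqnn r) wU cU dw.
have := commutator_cong uU vU du dv => /(@pdvd_le _ _ _ (b + b + r)).
rewrite leq_add2l leqnSn => /(_ isT) dc /(_ dc) /(pdvd_kill bsr)/eqP.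
rewrite mulrnBl subr_eq0 powE commE -/(der a _) => /eqP <-.
by rewrite mulrnDl !mulrnBl !(mulrnAl, mulrnAr).
Qed.

Lemma der_L a x : a \in aut_filter s -> L x -> L (der a x).
Proof.
move=> as_ /unit_liftP[uU _]; have [y Ly /(pdvd_kill bsr')/eqP] := aut_tangent as_ uU.
by rewrite mulrnBl subr_eq0 -/(der a x) => /eqP ->; do 2!apply: L_Mn.
Qed.

Lemma der_tors a x : a \in aut_filter s -> L x -> der a x *+ p ^ r = 0.
Proof.
move=> as_ /unit_liftP[uU _]; have [_ ha] := (in_aut_filter a bs).1 as_.
have /(pdvd_kill bs) := ha _ uU; rewrite /der -mulrnA -expnD.
by congr (_ *+ p ^ _ = _); clear - bsr; lia.
Qed.

(** The unit a u has the same tangent vector as u to the precision r, as r <= s. *)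
Lemma derM a c x : a \in aut_filter s -> c \in aut_filter s -> L x ->
  der (a * c)%g x = der a x + der c x.
Proof.
move=> as_ cs Lx; have [uU du] := unit_liftP Lx.
have [aU ha] := (in_aut_filter a bs).1 as_.
rewrite {1}/der permM -[val (c _) - _](subrKA (val (a (unit_lift x)))) mulrnDl.
rewrite addrC; congr (_ + _); apply: der_unit => //; first exact: Aut_closed.
rewrite -addrA -[X in X + _](subrK (val (unit_lift x))) -!addrA addrA.
apply: pdvdD; last by rewrite addrA; apply: pdvd_le du; clear; lia.
by apply: pdvd_le (ha _ uU); rewrite leq_add2l.
Qed.

Lemma derX a n x : a \in aut_filter s -> L x -> der (a ^+ n)%g x = der a x *+ n.
Proof.
move=> as_ Lx; elim: n => [|n IH].
  by rewrite expg0 /der perm1 subrr mul0rn.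
by rewrite expgS derM ?groupX // IH mulrS.
Qed.

Lemma der_small a : a \in aut_filter s ->
  (forall x, L x -> der a x *+ p ^ r.-1 = 0) -> a \in aut_filter s.+1.
Proof.
move=> as_ small; have [aU _] := (in_aut_filter a bs).1 as_.
rewrite inE aU; apply/'forall_implyP => u uU.
have [x Lx dx] := U_tangent (leqnn b) uU (U_base uU).
have := small x Lx; rewrite -(der_unit as_ uU Lx); last by apply: pdvd_le dx; clear; lia.
rewrite -mulrnA -expnD => /eqP; congr (_ *+ p ^ _ == 0).
by clear - bsr r_gt0; lia.
Qed.

Lemma aut_filterS_sub : aut_filter s.+1 \subset aut_filter s.
Proof.
apply/subsetP => a; rewrite inE => /andP[aU /'forall_implyP ha].
rewrite inE aU; apply/'forall_implyP => u uU.
have := ha u uU; rewrite (_ : e - (b + s) = (e - (b + s.+1)) + 1)%N.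
  by move/eqP => E; rewrite expnD mulrnA E mul0rn.
by clear - bsr r_gt0; lia.
Qed.

Definition der_coord a : 'rV[V]_m := \row_j coord j (der a (probe j)).

Lemma der_coordM :
  {in aut_filter s &, {morph der_coord : a c / (a * c)%g >-> (a * c)%g}}.
Proof.
move=> a c as_ cs; apply/rowP => j.
by rewrite FinRing.zmodMgE !mxE derM // coordD.
Qed.

Lemma card_torsion_row : (#|[set f : 'rV[V]_m | f *+ p == 0%R]| <= p ^ m)%N.
Proof.
apply: leq_trans (_ : (#|[set v : V | v *+ p == 0%R]| ^ m <= _)%N); last first.
  by case: (m) => // m'; rewrite leq_exp2r.
pose f (x : 'rV[V]_m) := [ffun j => x 0 j].
have f_inj : injective f.
  by move=> x y /ffunP fxy; apply/rowP => j; have := fxy j; rewrite !ffunE.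
rewrite -(card_imset _ f_inj) -[X in (_ ^ X)%N]card_ord -card_ffun_on.
apply: subset_leq_card; apply/subsetP => _ /imsetP[x + ->].
rewrite inE => /eqP x0; apply/ffun_onP => j.
by rewrite inE ffunE -mulmxnE x0 mxE.
Qed.

(** The m coordinates of the derivation attached to a define a morphism to the m-th
power of V whose kernel lies in aut_filter s.+1, and a^p has derivation p D,
which is killed by p^(r-1). *)
Lemma card_aut_filter : (#|aut_filter s| <= p ^ m * #|aut_filter s.+1|)%N.
Proof.
have kerS : 'ker (Morphism der_coordM) \subset aut_filter s.+1.
  apply/subsetP => a /morphpreP[as_ /set1P coord0].
  apply: der_small => //; apply: probeP => [x|x y|x y|x|j].
  - exact: der_L.
  - exact: derD.
  - exact: der_br.
  - exact: der_tors.
  - by move/rowP: coord0 => /(_ j); rewrite !mxE.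
have powS a : a \in aut_filter s -> (a ^+ p)%g \in aut_filter s.+1.
  move=> as_; apply: der_small; first by rewrite groupX.
  by move=> x Lx; rewrite derX // -mulrnA -expnS prednK //; exact: der_tors.
apply: leq_trans (card_le_pow_quotient aut_filterS_sub kerS powS) _.
by rewrite leq_mul2r card_torsion_row orbT.
Qed.

End Derivation.

Section Crude.
Let T := [set x : A | x *+ p == 0%R].

(** Modulo aut_filter s.+1, an automorphism is determined by the next digit of its
displacement at representatives of U modulo p^(b+1): by pdvd_aut_sub it moves
congruent elements in the same way.  Both digits and residue classes are encoded
by elements of the p-torsion T, so at most |T|^|T| cases arise. *)
Lemma card_aut_filter_crude s : (b + s.+1 <= e)%N ->
  (#|aut_filter s| <= #|T| ^ #|T| * #|aut_filter s.+1|)%N.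
Proof.
move=> bs1; have bs : (b + s <= e)%N by clear - bs1; lia.
have torsE k (x : A) : (k.+1 <= e)%N -> pdvd p k x -> x *+ p ^ (e - k.+1) \in T.
  move=> ke [y ->]; rewrite inE -!mulrnA -expnSr -expnD.
  by rewrite (_ : k + _ = e)%N ?expA //; clear - ke; lia.
pose rep t := odflt 1%g [pick u in U | (val u - 1) *+ p ^ (e - b.+1) == t].
have repU t : rep t \in U by rewrite /rep; case: pickP => [u /andP[]|_ //=].
pose f a := [ffun t => if t \in T then
  (val (a (rep t)) - val (rep t)) *+ p ^ (e - (b + s).+1) else 0].
rewrite -(card_pffun_on (0 : A)); apply: (@card_le_fibers _ _ f) => [a as_|a as_].
  have [_ ha] := (in_aut_filter a bs).1 as_.
  apply/pffun_onP; split=> [|_ /imageP[t tT ->]].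
    apply/subsetP => t; apply: contraLR => /negbTE tT.
    by rewrite inE /f ffunE tT eqxx.
  by rewrite ffunE tT; apply: torsE; [rewrite -addnS | exact: ha].
rewrite -[leqRHS](card_lcoset _ a); apply: subset_leq_card; apply/subsetP => c.
move=> /setIdP[cs /eqP fca]; rewrite mem_lcoset.
have [[aU ha] [cU hc]] := ((in_aut_filter a bs).1 as_, (in_aut_filter c bs).1 cs).
rewrite inE groupM ?groupV //; apply/'forall_implyP => u uU.
have [v vU ->] : exists2 v, v \in U & u = a v.
  by exists (a^-1 u)%g; rewrite ?permKV // Aut_closed ?groupV.
rewrite permM permK; pose t := (val v - 1) *+ p ^ (e - b.+1).
have tT : t \in T by apply: torsE; [clear - bs1; lia | exact: U_base].
have rept : pdvd p b.+1 (val v - val (rep t)).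
  have be : (b.+1 <= e)%N by clear - bs1; lia.
  apply/(pdvdP _ be); rewrite (_ : _ - _ = val v - 1 - (val (rep t) - 1)); last first.
    by rewrite opprB addrA subrK.
  rewrite mulrnBl -/t subr_eq0 eq_sym.
  by rewrite /rep; case: pickP => [w /andP[_]//|/(_ v)]; rewrite vU eqxx.
have near d : d \in aut_filter s -> pdvd p (b + s.+1)
    (val (d v) - val v - (val (d (rep t)) - val (rep t))).
  move=> ds; have [dU hd] := (in_aut_filter d bs).1 ds.
  apply: (@pdvd_aut_sub _ _ _ (b + s)) => //; first by clear; lia.
    exact: hd.
  rewrite addnS -addSn; apply: aut_filter_level; rewrite ?groupM ?groupV //.
  exact: val_coset.
have /eqP := pdvd_kill bs1 (near _ as_); have /eqP := pdvd_kill bs1 (near _ cs).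
have /ffunP/(_ t) := fca; rewrite /f !ffunE tT -addnS => E.
rewrite mulrnBl subr_eq0 E => /eqP Ec; rewrite mulrnBl subr_eq0 -Ec => /eqP Ea.
rewrite (_ : _ - _ = val (c v) - val v - (val (a v) - val v)); last first.
  by rewrite opprB addrA subrK.
by rewrite mulrnBl Ea subrr.
Qed.

Lemma aut_filter0 : aut_filter 0 = Aut U.
Proof.
apply/setP => a; rewrite inE andbC; case: (boolP (a \in Aut U)) => [aU|]; last by rewrite andbF.
rewrite andbT; apply/'forall_implyP => u uU; rewrite addn0.
have [eb|be] := leqP e b; last exact/(pdvdP _ (ltnW be))/pdvd_aut_base.
by rewrite (pdvd_exp0 eb (pdvd_aut_base aU uU)) mul0rn.
Qed.

Lemma card_aut_filter_top s : (e <= b + s)%N -> #|aut_filter s| = 1%N.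
Proof.
move=> es; rewrite (_ : aut_filter s = 1%g) ?cards1 //.
apply/trivgP/subsetP => a; rewrite inE => /andP[aU /'forall_implyP ha].
rewrite inE; apply/eqP; apply: (eq_Aut aU (group1 _)) => u uU.
have := ha u uU; rewrite (eqP (_ : e - (b + s) == 0)%N) //.
by rewrite mulr1n subr_eq0 perm1 => /eqP /val_inj.
Qed.

(** The sharp bound applies to the n + 1 steps r <= s <= r + n, and the crude one to
the r steps below and the 2 r steps above; the latter reach e = b + (3 r + n + 1),
where the filtration is trivial, as b = r + 1. *)
Lemma card_Aut_le n : e = (b + b + r + r + n)%N ->
  (#|Aut U| <= (#|T| ^ #|T|) ^ (r + (r + r)) * (p ^ m) ^ n.+1)%N.
Proof.
move=> eE; set C := (#|T| ^ #|T|)%N.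
have crude k s : (b + s + k <= e)%N ->
    (#|aut_filter s| <= C ^ k * #|aut_filter (s + k)|)%N.
  elim: k s => [|k IH] s bsk; first by rewrite addn0 mul1n.
  apply: leq_trans (card_aut_filter_crude _) _; first by clear - bsk; lia.
  by rewrite expnS -mulnA leq_mul2l -addSnnS IH ?orbT //; clear - bsk; lia.
have fine k : (k <= n.+1)%N ->
    (#|aut_filter r| <= (p ^ m) ^ k * #|aut_filter (r + k)|)%N.
  elim: k => [|k IH] kn; first by rewrite addn0 mul1n.
  apply: leq_trans (IH (ltnW kn)) _; rewrite expnSr -mulnA leq_mul2l addnS.
  by rewrite card_aut_filter ?orbT //; clear - kn eE; lia.
rewrite -aut_filter0; apply: leq_trans (crude r 0%N _) _; first by clear - eE; lia.
rewrite expnD -mulnA leq_mul2l; apply/orP; right.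
apply: leq_trans (fine n.+1 (leqnn _)) _; rewrite mulnC leq_mul2r; apply/orP; right.
apply: leq_trans (crude (r + r) _ _) _; first by clear - eE; lia.
by rewrite card_aut_filter_top ?muln1 //; clear - eE; lia.
Qed.

End Crude.
End UniformGroup.

(** * A block matrix ring *)

(** Block matrices with rows (s, a, z), (0, g * 1, v), (0, 0, s), where s is a scalar,
g a 2 x 2 matrix, a = (ai) a triple of row vectors (ai, bi), v = (vi) a triple of
column vectors (xi, yi).  The corner block of a product receives the three scalars
ai vi', which are mapped to R^2 by sending the basis vectors of R^3 to q1 = (1, 0),
q2 = (0, 1) and q3 = (1, 1).  The product stays associative because g acts on all
three indices in the same way. *)
Definition jac (R : Type) : Type :=
  R * (R * R * R * R) * ((R * R) * (R * R) * (R * R))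
  * ((R * R) * (R * R) * (R * R)) * (R * R).

Section JacobiRing.
Variable R : comNzRingType.

Definition Jac (s g11 g12 g21 g22 a1 b1 a2 b2 a3 b3 x1 y1 x2 y2 x3 y3 z1 z2 : R) :
  jac R :=
  (s, (g11, g12, g21, g22), ((a1, b1), (a2, b2), (a3, b3)),
   ((x1, y1), (x2, y2), (x3, y3)), (z1, z2)).

Definition jmul (u v : jac R) : jac R :=
  let: (s, (g11, g12, g21, g22), ((a1, b1), (a2, b2), (a3, b3)),
        ((x1, y1), (x2, y2), (x3, y3)), (z1, z2)) := u in
  let: (s', (g11', g12', g21', g22'), ((a1', b1'), (a2', b2'), (a3', b3')),
        ((x1', y1'), (x2', y2'), (x3', y3')), (z1', z2')) := v in
  Jac (s * s')
    (g11 * g11' + g12 * g21') (g11 * g12' + g12 * g22')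
    (g21 * g11' + g22 * g21') (g21 * g12' + g22 * g22')
    (s * a1' + a1 * g11' + b1 * g21') (s * b1' + a1 * g12' + b1 * g22')
    (s * a2' + a2 * g11' + b2 * g21') (s * b2' + a2 * g12' + b2 * g22')
    (s * a3' + a3 * g11' + b3 * g21') (s * b3' + a3 * g12' + b3 * g22')
    (g11 * x1' + g12 * y1' + x1 * s') (g21 * x1' + g22 * y1' + y1 * s')
    (g11 * x2' + g12 * y2' + x2 * s') (g21 * x2' + g22 * y2' + y2 * s')
    (g11 * x3' + g12 * y3' + x3 * s') (g21 * x3' + g22 * y3' + y3 * s')
    (s * z1' + z1 * s' + (a1 * x1' + b1 * y1') + (a3 * x3' + b3 * y3'))
    (s * z2' + z2 * s' + (a2 * x2' + b2 * y2') + (a3 * x3' + b3 * y3')).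

Definition jone : jac R := Jac 1 1 0 0 1 0 0 0 0 0 0 0 0 0 0 0 0 0 0.

HB.instance Definition _ := GRing.Zmodule.on (jac R).

Lemma jacP (P : jac R -> Prop) :
  (forall s g11 g12 g21 g22 a1 b1 a2 b2 a3 b3 x1 y1 x2 y2 x3 y3 z1 z2,
     P (Jac s g11 g12 g21 g22 a1 b1 a2 b2 a3 b3 x1 y1 x2 y2 x3 y3 z1 z2)) ->
  forall u, P u.
Proof.
move=> PJ [[[[s [[[? ?] ?] ?]] [[[? ?] [? ?]] [? ?]]] [[[? ?] [? ?]] [? ?]]] [? ?]].
exact: PJ.
Qed.

Ltac jring :=
  rewrite /jmul /jone /=; congr (Jac _ _ _ _ _ _ _ _ _ _ _ _ _ _ _ _ _ _ _); ring.

Lemma jmulA : associative jmul.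
Proof.
elim/jacP=> s g11 g12 g21 g22 a1 b1 a2 b2 a3 b3 x1 y1 x2 y2 x3 y3 z1 z2.
elim/jacP=> s' g11' g12' g21' g22' a1' b1' a2' b2' a3' b3' x1' y1' x2' y2' x3' y3' z1' z2'.
elim/jacP=> *; jring.
Qed.

Lemma jmul1r : left_id jone jmul.
Proof. elim/jacP=> *; jring. Qed.

Lemma jmulr1 : right_id jone jmul.
Proof. elim/jacP=> *; jring. Qed.

Lemma JacD s g11 g12 g21 g22 a1 b1 a2 b2 a3 b3 x1 y1 x2 y2 x3 y3 z1 z2
  s' g11' g12' g21' g22' a1' b1' a2' b2' a3' b3' x1' y1' x2' y2' x3' y3' z1' z2' :
  Jac s g11 g12 g21 g22 a1 b1 a2 b2 a3 b3 x1 y1 x2 y2 x3 y3 z1 z2 +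
  Jac s' g11' g12' g21' g22' a1' b1' a2' b2' a3' b3' x1' y1' x2' y2' x3' y3' z1' z2' =
  Jac (s + s') (g11 + g11') (g12 + g12') (g21 + g21') (g22 + g22')
   (a1 + a1') (b1 + b1') (a2 + a2') (b2 + b2') (a3 + a3') (b3 + b3')
   (x1 + x1') (y1 + y1') (x2 + x2') (y2 + y2') (x3 + x3') (y3 + y3')
   (z1 + z1') (z2 + z2').
Proof. by []. Qed.

Lemma jmulDl : left_distributive jmul +%R.
Proof.
elim/jacP=> s g11 g12 g21 g22 a1 b1 a2 b2 a3 b3 x1 y1 x2 y2 x3 y3 z1 z2.
elim/jacP=> s' g11' g12' g21' g22' a1' b1' a2' b2' a3' b3' x1' y1' x2' y2' x3' y3' z1' z2'.
elim/jacP=> *; rewrite [X in jmul X]JacD /jmul /= JacD; jring.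
Qed.

Lemma jmulDr : right_distributive jmul +%R.
Proof.
elim/jacP=> s g11 g12 g21 g22 a1 b1 a2 b2 a3 b3 x1 y1 x2 y2 x3 y3 z1 z2.
elim/jacP=> s' g11' g12' g21' g22' a1' b1' a2' b2' a3' b3' x1' y1' x2' y2' x3' y3' z1' z2'.
elim/jacP=> *; rewrite [X in jmul _ X]JacD /jmul /= JacD; jring.
Qed.

Lemma jone_neq0 : jone != 0.
Proof. by apply/eqP => -[/eqP]; rewrite oner_eq0. Qed.

HB.instance Definition _ :=
  GRing.Zmodule_isNzRing.Build (jac R) jmulA jmul1r jmulr1 jmulDl jmulDr jone_neq0.

End JacobiRing.

(** The geometric series in 1 - x terminates. *)
Lemma near_one_inv p e (B : pzRingType) (x : B) :
  (forall y : B, y *+ p ^ e = 0) -> pdvd p 1 (x - 1) ->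
  exists y, y * x = 1 /\ x * y = 1.
Proof.
move=> expB d1; pose n := 1 - x; exists (\sum_(i < e) n ^+ i).
have nE : n ^+ e = 0.
  have: pdvd p e (n ^+ e).
    elim: (e) => [|k IH]; first by exists 1; rewrite mulr1n.
    by rewrite exprS -add1n; apply: pdvdM => //; apply: pdvdBC.
  by case=> y ->; apply: expB.
have xE : x * (\sum_(i < e) n ^+ i) = 1.
  have := subrX1 n e; rewrite nE sub0r /n addrAC subrr add0r mulNr.
  by move/oppr_inj.
split=> //; rewrite -[RHS]xE; apply/esym/commr_sum => i _.
by apply: commrX; apply: commrB; [exact: commr1 | exact: commr_refl].
Qed.

Section JacobiUnits.
Variable R : finComNzRingType.

HB.instance Definition _ := Finite.on (jac R).

Definition junit : {pred jac R} :=
  fun u => [exists v : jac R, (v * u == 1) && (u * v == 1)].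

Definition jinv (u : jac R) : jac R :=
  odflt u [pick v : jac R | (v * u == 1) && (u * v == 1)].

Lemma jmulVr : {in junit, left_inverse 1 jinv *%R}.
Proof.
move=> u /existsP[v uv]; rewrite /jinv; case: pickP => [w /andP[/eqP]//|/(_ v)].
by rewrite uv.
Qed.

Lemma jmulrV : {in junit, right_inverse 1 jinv *%R}.
Proof.
move=> u /existsP[v uv]; rewrite /jinv; case: pickP => [w /andP[_ /eqP]//|/(_ v)].
by rewrite uv.
Qed.

Lemma junitP u v : v * u = 1 /\ u * v = 1 -> u \in junit.
Proof. by case=> uv vu; apply/existsP; exists v; rewrite uv vu !eqxx. Qed.

Lemma jinv_out : {in [predC junit], jinv =1 id}.
Proof.
move=> u uN; rewrite /jinv; case: pickP => //= v uv.
by case/negP: uN; apply/existsP; exists v.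
Qed.

HB.instance Definition _ :=
  GRing.NzRing_hasMulInverse.Build (jac R) jmulVr jmulrV junitP jinv_out.

End JacobiUnits.

(** * The group of points and its congruence subgroups *)

(** Coordinates (a, b, c) for the matrix with rows (a, b), (c, -a) in sl2, then (xi, yi)
for V * E and (z1, z2) for Q. *)
Definition lie (T : Type) : Type :=
  (T * T * T) * ((T * T) * (T * T) * (T * T)) * (T * T).

Definition Lie (T : Type) (a b c x1 y1 x2 y2 x3 y3 z1 z2 : T) : lie T :=
  ((a, b, c), ((x1, y1), (x2, y2), (x3, y3)), (z1, z2)).

Lemma lieP (T : Type) (P : lie T -> Prop) :
  (forall a b c x1 y1 x2 y2 x3 y3 z1 z2, P (Lie a b c x1 y1 x2 y2 x3 y3 z1 z2)) ->
  forall t, P t.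
Proof.
by move=> PL [[[[? ?] ?] [[[? ?] [? ?]] [? ?]]] [? ?]]; exact: PL.
Qed.

HB.instance Definition _ (V : zmodType) := GRing.Zmodule.on (lie V).
HB.instance Definition _ (T : finType) := Finite.on (lie T).

Section LieZmodule.
Variable R : zmodType.

Lemma LieD (a b c x1 y1 x2 y2 x3 y3 z1 z2 a' b' c' x1' y1' x2' y2' x3' y3' z1' z2' : R) :
  Lie a b c x1 y1 x2 y2 x3 y3 z1 z2 + Lie a' b' c' x1' y1' x2' y2' x3' y3' z1' z2' =
  Lie (a + a') (b + b') (c + c') (x1 + x1') (y1 + y1') (x2 + x2') (y2 + y2')
    (x3 + x3') (y3 + y3') (z1 + z1') (z2 + z2').
Proof. by []. Qed.

Lemma LieMn (a b c x1 y1 x2 y2 x3 y3 z1 z2 : R) n :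
  Lie a b c x1 y1 x2 y2 x3 y3 z1 z2 *+ n =
  Lie (a *+ n) (b *+ n) (c *+ n) (x1 *+ n) (y1 *+ n) (x2 *+ n) (y2 *+ n)
    (x3 *+ n) (y3 *+ n) (z1 *+ n) (z2 *+ n).
Proof. by elim: n => [|n IH] //; rewrite !mulrS IH LieD. Qed.

End LieZmodule.

Section JacobiGroup.
Variables (p e : nat) (R : finComNzRingType).
Hypothesis expR : forall x : R, x *+ p ^ e = 0.
Hypothesis torsR : forall k (x : R), (k <= e)%N -> x *+ p ^ k = 0 -> pdvd p (e - k) x.

Lemma JacMn (s g11 g12 g21 g22 a1 b1 a2 b2 a3 b3 x1 y1 x2 y2 x3 y3 z1 z2 : R) n :
  Jac s g11 g12 g21 g22 a1 b1 a2 b2 a3 b3 x1 y1 x2 y2 x3 y3 z1 z2 *+ n =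
  Jac (s *+ n) (g11 *+ n) (g12 *+ n) (g21 *+ n) (g22 *+ n)
    (a1 *+ n) (b1 *+ n) (a2 *+ n) (b2 *+ n) (a3 *+ n) (b3 *+ n)
    (x1 *+ n) (y1 *+ n) (x2 *+ n) (y2 *+ n) (x3 *+ n) (y3 *+ n)
    (z1 *+ n) (z2 *+ n).
Proof. by elim: n => [|n IH] //; rewrite !mulrS IH JacD. Qed.

Lemma pdvd_Jac k (s g11 g12 g21 g22 a1 b1 a2 b2 a3 b3 x1 y1 x2 y2 x3 y3 z1 z2 : R) :
  pdvd p k s -> pdvd p k g11 -> pdvd p k g12 -> pdvd p k g21 -> pdvd p k g22 ->
  pdvd p k a1 -> pdvd p k b1 -> pdvd p k a2 -> pdvd p k b2 -> pdvd p k a3 ->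
  pdvd p k b3 -> pdvd p k x1 -> pdvd p k y1 -> pdvd p k x2 -> pdvd p k y2 ->
  pdvd p k x3 -> pdvd p k y3 -> pdvd p k z1 -> pdvd p k z2 ->
  pdvd p k (Jac s g11 g12 g21 g22 a1 b1 a2 b2 a3 b3 x1 y1 x2 y2 x3 y3 z1 z2).
Proof.
move=> [s' ->] [g11' ->] [g12' ->] [g21' ->] [g22' ->] [a1' ->] [b1' ->] [a2' ->].
move=> [b2' ->] [a3' ->] [b3' ->] [x1' ->] [y1' ->] [x2' ->] [y2' ->] [x3' ->].
move=> [y3' ->] [z1' ->] [z2' ->].
exists (Jac s' g11' g12' g21' g22' a1' b1' a2' b2' a3' b3' x1' y1' x2' y2' x3' y3' z1' z2').
by rewrite JacMn.
Qed.

Lemma expJ (u : jac R) : u *+ p ^ e = 0.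
Proof. by elim/jacP: u => *; rewrite JacMn !expR. Qed.

Lemma torsJ k (u : jac R) : (k <= e)%N -> u *+ p ^ k = 0 -> pdvd p (e - k) u.
Proof.
move=> ke.
elim/jacP: u => s g11 g12 g21 g22 a1 b1 a2 b2 a3 b3 x1 y1 x2 y2 x3 y3 z1 z2.
by rewrite JacMn; case=> *; apply: pdvd_Jac; apply: torsR.
Qed.

(** The semidirect product of SL2 with a Heisenberg-like group: s = 1, g has
determinant 1, and the row ai is vi^T J g with J the matrix of the symplectic form,
so that only g, v and z are free. *)
Definition jgroup (u : jac R) : bool :=
  let: (s, (g11, g12, g21, g22), ((a1, b1), (a2, b2), (a3, b3)),
        ((x1, y1), (x2, y2), (x3, y3)), (z1, z2)) := u in
  (s, g11 * g22 - g12 * g21, ((a1, b1), (a2, b2), (a3, b3))) ==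
  (1, 1, ((x1 * g21 - y1 * g11, x1 * g22 - y1 * g12),
          (x2 * g21 - y2 * g11, x2 * g22 - y2 * g12),
          (x3 * g21 - y3 * g11, x3 * g22 - y3 * g12))).

(** Closure under products of the condition on rows amounts to g^T J g = J. *)
Lemma symp_row (g11 g12 g21 g22 h1 h2 x y x' y' : R) : g11 * g22 - g12 * g21 = 1 ->
  1 * (x' * h2 - y' * h1) + (x * g21 - y * g11) * h1 + (x * g22 - y * g12) * h2 =
  (g11 * x' + g12 * y' + x * 1) * (g21 * h1 + g22 * h2)
   - (g21 * x' + g22 * y' + y * 1) * (g11 * h1 + g12 * h2).
Proof.
move=> det1; apply/eqP; rewrite -subr_eq0; apply/eqP.
transitivity ((1 - (g11 * g22 - g12 * g21)) * (x' * h2 - y' * h1)); first by ring.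
by rewrite det1 subrr mul0r.
Qed.

Lemma jgroup1 : jgroup 1.
Proof. by rewrite /jgroup /= !(mul0r, mulr0, mulr1, subr0). Qed.

Lemma jgroupM u v : jgroup u -> jgroup v -> jgroup (u * v).
Proof.
elim/jacP: u => s g11 g12 g21 g22 a1 b1 a2 b2 a3 b3 x1 y1 x2 y2 x3 y3 z1 z2.
elim/jacP: v => s' h11 h12 h21 h22 a1' b1' a2' b2' a3' b3' x1' y1' x2' y2' x3' y3' z1' z2'.
move=> /eqP[-> det1 -> -> -> -> -> ->] /eqP[-> det1' -> -> -> -> -> ->].
rewrite /jgroup /= !symp_row //; apply/eqP; congr (_, _, _); first by rewrite mulr1.
by rewrite -[RHS]mulr1 -{1}det1 -det1'; ring.
Qed.

Variable b : nat.
Hypothesis b_gt0 : (0 < b)%N.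

Definition jcong : {set {unit jac R}} :=
  [set u | jgroup (val u) && ((val u - 1) *+ p ^ (e - b) == 0)].

Lemma jcong_group_set : group_set jcong.
Proof.
apply/group_setP; split; first by rewrite inE jgroup1 subrr mul0rn eqxx.
move=> u v; rewrite !inE => /andP[gu /eqP du] /andP[gv /eqP dv].
rewrite jgroupM //=.
have -> : val u * val v - 1 = (val u - 1) * val v + (val v - 1).
  by rewrite mulrBl mul1r addrA subrK.
by rewrite mulrnDl -mulrnAl du mul0r dv addr0.
Qed.
Canonical jcong_group := group jcong_group_set.

(** The tangent space of the group: the condition on rows becomes ai = vi^T J. *)
Definition ell (t : lie R) : jac R :=
  let: ((a, b, c), ((x1, y1), (x2, y2), (x3, y3)), (z1, z2)) := t in
  Jac 0 a b c (- a) (- y1) x1 (- y2) x2 (- y3) x3 x1 y1 x2 y2 x3 y3 z1 z2.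

Definition jlie (u : jac R) := exists t, u = ell t.

Lemma JacB s g11 g12 g21 g22 a1 b1 a2 b2 a3 b3 x1 y1 x2 y2 x3 y3 z1 z2
  s' g11' g12' g21' g22' a1' b1' a2' b2' a3' b3' x1' y1' x2' y2' x3' y3' z1' z2' :
  Jac s g11 g12 g21 g22 a1 b1 a2 b2 a3 b3 x1 y1 x2 y2 x3 y3 z1 z2 -
  Jac s' g11' g12' g21' g22' a1' b1' a2' b2' a3' b3' x1' y1' x2' y2' x3' y3' z1' z2' =
  Jac (s - s' : R) (g11 - g11') (g12 - g12') (g21 - g21') (g22 - g22')
   (a1 - a1') (b1 - b1') (a2 - a2') (b2 - b2') (a3 - a3') (b3 - b3')
   (x1 - x1') (y1 - y1') (x2 - x2') (y2 - y2') (x3 - x3') (y3 - y3')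
   (z1 - z1') (z2 - z2').
Proof. by []. Qed.

Lemma jac1E : 1 = Jac 1 1 0 0 1 0 0 0 0 0 0 0 0 0 0 0 0 0 0 :> jac R.
Proof. by []. Qed.

Lemma eq_of_sub (x y z t : R) : x - y = z - t -> z = t -> x = y.
Proof. by move=> xyzt zt; apply/eqP; rewrite -subr_eq0 xyzt zt subrr. Qed.

Lemma pdvd_sq k (w x : R) : x = w * (p ^ k)%:R * (p ^ k)%:R -> pdvd p (k + k) x.
Proof. by move=> ->; exists w; rewrite expnD mulrnA !mulr_natr. Qed.

(** Linearizing the defining equations at 1 leaves an error that is quadratic in the
displacement. *)
Lemma jcong_tangent k u : (b <= k)%N -> u \in jcong -> pdvd p k (val u - 1) ->
  exists2 x, jlie x & pdvd p (k + k) (val u - 1 - x *+ p ^ k).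
Proof.
move=> bk; rewrite inE => /andP[gu _] [w].
elim/jacP: w => s' h11 h12 h21 h22 a1' b1' a2' b2' a3' b3' x1 y1 x2 y2 x3 y3 z1 z2.
move/(canRL (subrK _)); rewrite JacMn JacD !addr0 => uE; move: gu; rewrite uE.
move=> /eqP[sE det1 a1E b1E a2E b2E a3E b3E].
exists (ell (Lie h11 h12 h21 x1 y1 x2 y2 x3 y3 z1 z2)); first by eexists.
rewrite /ell /= JacMn jac1E [X in X - _]JacB JacB.
apply: pdvd_Jac.
- by apply: (@pdvd_sq _ 0); apply: eq_of_sub sE; ring.
- by apply: (@pdvd_sq _ 0); ring.
- by apply: (@pdvd_sq _ 0); ring.
- by apply: (@pdvd_sq _ 0); ring.
- by apply: (@pdvd_sq _ (h12 * h21 - h11 * h22)); apply: eq_of_sub det1; ring.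
- by apply: (@pdvd_sq _ (x1 * h21 - y1 * h11)); apply: eq_of_sub a1E; ring.
- by apply: (@pdvd_sq _ (x1 * h22 - y1 * h12)); apply: eq_of_sub b1E; ring.
- by apply: (@pdvd_sq _ (x2 * h21 - y2 * h11)); apply: eq_of_sub a2E; ring.
- by apply: (@pdvd_sq _ (x2 * h22 - y2 * h12)); apply: eq_of_sub b2E; ring.
- by apply: (@pdvd_sq _ (x3 * h21 - y3 * h11)); apply: eq_of_sub a3E; ring.
- by apply: (@pdvd_sq _ (x3 * h22 - y3 * h12)); apply: eq_of_sub b3E; ring.
all: by apply: (@pdvd_sq _ 0); ring.
Qed.

Definition jchart (u : jac R) : lie R :=
  let: (_, (g11, g12, g21, _), _, ((x1, y1), (x2, y2), (x3, y3)), (z1, z2)) := u in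
  Lie (g11 - 1) g12 g21 x1 y1 x2 y2 x3 y3 z1 z2.

(** All 11 coordinates can be prescribed: the entry g22 is solved from det g = 1, g11
being invertible, and the rows are determined by the rest. *)
Lemma jcong_param (t : lie R) : exists2 u, u \in jcong &
  jchart (val u) = t *+ p ^ b /\ pdvd p (b + b) (val u - 1 - ell t *+ p ^ b).
Proof.
elim/lieP: t => a b' c x1 y1 x2 y2 x3 y3 z1 z2.
set q := (p ^ b)%:R : R.
have [t [tE _]] : exists t, t * (1 + a * q) = 1 /\ (1 + a * q) * t = 1.
  apply: (near_one_inv expR); exists (a *+ p ^ b.-1).
  by rewrite addrAC subrr add0r -mulrnA -expnD addn1 prednK // mulr_natr.
(* d = (1 + g12 g21) / g11 solves det g = 1 for the entry g22 *)
pose d := (1 + b' * q * (c * q)) * t.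
pose w := Jac 1 (1 + a * q) (b' * q) (c * q) d
  (x1 * q * (c * q) - y1 * q * (1 + a * q)) (x1 * q * d - y1 * q * (b' * q))
  (x2 * q * (c * q) - y2 * q * (1 + a * q)) (x2 * q * d - y2 * q * (b' * q))
  (x3 * q * (c * q) - y3 * q * (1 + a * q)) (x3 * q * d - y3 * q * (b' * q))
  (x1 * q) (y1 * q) (x2 * q) (y2 * q) (x3 * q) (y3 * q) (z1 * q) (z2 * q).
have dE : d - 1 + a * q = t * (b' * c + a * a) * q * q.
  by apply: eq_of_sub (congr1 ( *%R (1 - a * q)) tE); rewrite /d; ring.
have dw : pdvd p (b + b) (w - 1 - ell (Lie a b' c x1 y1 x2 y2 x3 y3 z1 z2) *+ p ^ b).
{ rewrite /ell /= JacMn jac1E [X in X - _]JacB JacB; apply: pdvd_Jac.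
  - by apply: (@pdvd_sq _ 0); rewrite /q; ring.
  - by apply: (@pdvd_sq _ 0); rewrite /q; ring.
  - by apply: (@pdvd_sq _ 0); rewrite /q; ring.
  - by apply: (@pdvd_sq _ 0); rewrite /q; ring.
  - by apply: (@pdvd_sq _ (t * (b' * c + a * a))); rewrite -dE /q; ring.
  - by apply: (@pdvd_sq _ (x1 * c - y1 * a)); rewrite /q; ring.
  - apply: (@pdvd_sq _ (x1 * (t * (b' * c + a * a) * q - a) - y1 * b')).
    by apply: eq_of_sub (congr1 ( *%R (x1 * q)) dE); rewrite /q; ring.
  - by apply: (@pdvd_sq _ (x2 * c - y2 * a)); rewrite /q; ring.
  - apply: (@pdvd_sq _ (x2 * (t * (b' * c + a * a) * q - a) - y2 * b')).
    by apply: eq_of_sub (congr1 ( *%R (x2 * q)) dE); rewrite /q; ring.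
  - by apply: (@pdvd_sq _ (x3 * c - y3 * a)); rewrite /q; ring.
  - apply: (@pdvd_sq _ (x3 * (t * (b' * c + a * a) * q - a) - y3 * b')).
    by apply: eq_of_sub (congr1 ( *%R (x3 * q)) dE); rewrite /q; ring.
  all: by apply: (@pdvd_sq _ 0); rewrite /q; ring. }
have dw1 : pdvd p b (w - 1).
  apply: (@pdvdDr _ _ _ _ (- (ell (Lie a b' c x1 y1 x2 y2 x3 y3 z1 z2) *+ p ^ b))).
    exact/pdvdN/pdvd_pow.
  by apply: pdvd_le dw; rewrite leq_addr.
have wu : w \is a GRing.unit.
  have [v vw] := near_one_inv expJ (pdvd_le b_gt0 dw1).
  exact: junitP vw.
exists (FinRing.Unit wu); last first.
  split=> //; rewrite LieMn /jchart /=.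
  by congr (Lie _ _ _ _ _ _ _ _ _ _ _); rewrite /q; ring.
rewrite inE /=; apply/andP; split; last first.
  have [be|eb] := leqP b e; first exact/(pdvdP expJ torsJ).
  by rewrite (pdvd_exp0 expJ (ltnW eb) dw1) mul0rn.
apply/eqP; congr (_, _, _).
by apply: eq_of_sub (congr1 ( *%R (1 + b' * q * (c * q))) tE); rewrite /d; ring.
Qed.

Lemma jcong_lift x : jlie x ->
  exists2 u, u \in jcong & pdvd p (b + b) (val u - 1 - x *+ p ^ b).
Proof. by case=> t ->; have [u uU [_ du]] := jcong_param t; exists u. Qed.

End JacobiGroup.

(** * Derivations of the Lie algebra *)

Section Derivations.
Variable R : finComNzRingType.
Hypothesis natR : forall x : R, exists n, x = n%:R.

Definition br (t t' : lie R) : lie R :=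
  let: ((a, b, c), ((x1, y1), (x2, y2), (x3, y3)), (z1, z2)) := t in
  let: ((a', b', c'), ((x1', y1'), (x2', y2'), (x3', y3')), (z1', z2')) := t' in
  let w1 := x1 * y1' - y1 * x1' in
  let w2 := x2 * y2' - y2 * x2' in
  let w3 := x3 * y3' - y3 * x3' in
  Lie (b * c' - b' * c) ((a * b' - b * a') *+ 2) ((c * a' - a * c') *+ 2)
    (a * x1' + b * y1' - a' * x1 - b' * y1) (c * x1' - a * y1' - c' * x1 + a' * y1)
    (a * x2' + b * y2' - a' * x2 - b' * y2) (c * x2' - a * y2' - c' * x2 + a' * y2)
    (a * x3' + b * y3' - a' * x3 - b' * y3) (c * x3' - a * y3' - c' * x3 + a' * y3)
    ((w1 + w3) *+ 2) ((w2 + w3) *+ 2).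

Lemma ellD (t t' : lie R) : ell (t + t') = ell t + ell t'.
Proof.
elim/lieP: t => a b c x1 y1 x2 y2 x3 y3 z1 z2.
elim/lieP: t' => a' b' c' x1' y1' x2' y2' x3' y3' z1' z2'.
rewrite LieD /ell /= JacD; congr (Jac _ _ _ _ _ _ _ _ _ _ _ _ _ _ _ _ _ _ _); ring.
Qed.

Lemma ellMn (t : lie R) n : ell (t *+ n) = ell t *+ n.
Proof.
elim: n => [|n IH]; last by rewrite !mulrS ellD IH.
by congr (Jac _ _ _ _ _ _ _ _ _ _ _ _ _ _ _ _ _ _ _); rewrite oppr0.
Qed.

Lemma JacM (s g11 g12 g21 g22 a1 b1 a2 b2 a3 b3 x1 y1 x2 y2 x3 y3 z1 z2
  s' g11' g12' g21' g22' a1' b1' a2' b2' a3' b3' x1' y1' x2' y2' x3' y3' z1' z2' : R) :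
  Jac s g11 g12 g21 g22 a1 b1 a2 b2 a3 b3 x1 y1 x2 y2 x3 y3 z1 z2 *
  Jac s' g11' g12' g21' g22' a1' b1' a2' b2' a3' b3' x1' y1' x2' y2' x3' y3' z1' z2' =
  Jac (s * s')
    (g11 * g11' + g12 * g21') (g11 * g12' + g12 * g22')
    (g21 * g11' + g22 * g21') (g21 * g12' + g22 * g22')
    (s * a1' + a1 * g11' + b1 * g21') (s * b1' + a1 * g12' + b1 * g22')
    (s * a2' + a2 * g11' + b2 * g21') (s * b2' + a2 * g12' + b2 * g22')
    (s * a3' + a3 * g11' + b3 * g21') (s * b3' + a3 * g12' + b3 * g22')
    (g11 * x1' + g12 * y1' + x1 * s') (g21 * x1' + g22 * y1' + y1 * s')
    (g11 * x2' + g12 * y2' + x2 * s') (g21 * x2' + g22 * y2' + y2 * s')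
    (g11 * x3' + g12 * y3' + x3 * s') (g21 * x3' + g22 * y3' + y3 * s')
    (s * z1' + z1 * s' + (a1 * x1' + b1 * y1') + (a3 * x3' + b3 * y3'))
    (s * z2' + z2 * s' + (a2 * x2' + b2 * y2') + (a3 * x3' + b3 * y3')).
Proof. by []. Qed.

Lemma ell_br (t t' : lie R) : ell (br t t') = ell t * ell t' - ell t' * ell t.
Proof.
elim/lieP: t => a b c x1 y1 x2 y2 x3 y3 z1 z2.
elim/lieP: t' => a' b' c' x1' y1' x2' y2' x3' y3' z1' z2'.
rewrite /ell /= [X in _ = X - _]JacM [X in _ = _ - X]JacM JacB.
by congr (Jac _ _ _ _ _ _ _ _ _ _ _ _ _ _ _ _ _ _ _); ring.
Qed.

Lemma ell_inj : injective (@ell R).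
Proof.
elim/lieP=> a b c x1 y1 x2 y2 x3 y3 z1 z2; elim/lieP=> a' b' c' x1' y1' x2' y2' x3' y3' z1' z2'.
by case=> -> -> -> _ _ _ _ _ _ _ -> -> -> -> -> -> -> ->.
Qed.

Definition lie_h : lie R := Lie 1 0 0 0 0 0 0 0 0 0 0.
Definition lie_e : lie R := Lie 0 1 0 0 0 0 0 0 0 0 0.
Definition lie_f : lie R := Lie 0 0 1 0 0 0 0 0 0 0 0.
Definition lie_x1 : lie R := Lie 0 0 0 1 0 0 0 0 0 0 0.
Definition lie_y1 : lie R := Lie 0 0 0 0 1 0 0 0 0 0 0.
Definition lie_x2 : lie R := Lie 0 0 0 0 0 1 0 0 0 0 0.
Definition lie_y2 : lie R := Lie 0 0 0 0 0 0 1 0 0 0 0.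
Definition lie_x3 : lie R := Lie 0 0 0 0 0 0 0 1 0 0 0.
Definition lie_y3 : lie R := Lie 0 0 0 0 0 0 0 0 1 0 0.
Definition lie_z1 : lie R := Lie 0 0 0 0 0 0 0 0 0 1 0.
Definition lie_z2 : lie R := Lie 0 0 0 0 0 0 0 0 0 0 1.

(** 12 is the least common multiple of 1, 2, 3 and 4, the possible differences of two
distinct weights of h, which lie between -2 and 2. *)
Definition tors12 (V : zmodType) (x : V) := x *+ 12 = 0.

Lemma tors12_int (k : int) (x : R) : k != 0 -> (`|k| <= 4)%N -> x *~ k = 0 -> tors12 x.
Proof.
move=> k0 k4 xk; have {}xk : x *+ `|k|%N = 0.
  by move: xk; case: (k) => n //; rewrite NegzE mulrNz => /eqP; rewrite oppr_eq0 => /eqP.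
have /dvdnP[j jE] : (`|k| %| 12)%N.
  by move: k4; rewrite -absz_gt0 in k0; case: `|k|%N k0 => [|[|[|[|[|n]]]]].
by rewrite /tors12 jE mulnC mulrnA xk mul0rn.
Qed.

Lemma tors12_Lie (a b c x1 y1 x2 y2 x3 y3 z1 z2 : R) :
  tors12 a -> tors12 b -> tors12 c -> tors12 x1 -> tors12 y1 -> tors12 x2 ->
  tors12 y2 -> tors12 x3 -> tors12 y3 -> tors12 z1 -> tors12 z2 ->
  tors12 (Lie a b c x1 y1 x2 y2 x3 y3 z1 z2).
Proof.
move=> Ta Tb Tc Tx1 Ty1 Tx2 Ty2 Tx3 Ty3 Tz1 Tz2; rewrite /tors12 LieMn.
by rewrite Ta Tb Tc Tx1 Ty1 Tx2 Ty2 Tx3 Ty3 Tz1 Tz2.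
Qed.

Lemma LieMz (a b c x1 y1 x2 y2 x3 y3 z1 z2 : R) (w : int) :
  Lie a b c x1 y1 x2 y2 x3 y3 z1 z2 *~ w =
  Lie (a *~ w) (b *~ w) (c *~ w) (x1 *~ w) (y1 *~ w) (x2 *~ w) (y2 *~ w)
    (x3 *~ w) (y3 *~ w) (z1 *~ w) (z2 *~ w).
Proof.
case: w => n; first exact: LieMn.
by rewrite NegzE !mulrNz -!pmulrn LieMn.
Qed.

(** An element of weight w for h has its components of other weights killed by
differences of weights, hence by 12. *)
Lemma weight_torsion (w : int) (a b c x1 y1 x2 y2 x3 y3 z1 z2 : R) :
  (`|w| <= 2)%N ->
  let t := Lie a b c x1 y1 x2 y2 x3 y3 z1 z2 in
  br lie_h t = t *~ w ->
  [/\ w != 0 -> tors12 a, w != 2 -> tors12 b & w != -2 -> tors12 c] /\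
  [/\ w != 1 -> tors12 x1, w != 1 -> tors12 x2 & w != 1 -> tors12 x3] /\
  [/\ w != -1 -> tors12 y1, w != -1 -> tors12 y2 & w != -1 -> tors12 y3] /\
  (w != 0 -> tors12 z1) /\ (w != 0 -> tors12 z2).
Proof.
move=> w2; rewrite /= LieMz => -[Ea Eb Ec Ex1 Ey1 Ex2 Ey2 Ex3 Ey3 Ez1 Ez2].
have tor k (x : R) y : y = x *~ w -> y = x *~ k -> w != k -> (`|k| <= 2)%N -> tors12 x.
  move=> -> wk nwk k2; apply: (@tors12_int (w - k)); first by rewrite subr_eq0.
    by clear - w2 k2; lia.
  by rewrite mulrzBr wk subrr.
split; [split=> ww|split; [split=> ww|split; [split=> ww|split=> ww]]].
- by apply: (tor 0) Ea _ ww _ => //; ring.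
- by apply: (tor 2) Eb _ ww _ => //; ring.
- by apply: (tor (-2)) Ec _ ww _ => //; ring.
- by apply: (tor 1) Ex1 _ ww _ => //; ring.
- by apply: (tor 1) Ex2 _ ww _ => //; ring.
- by apply: (tor 1) Ex3 _ ww _ => //; ring.
- by apply: (tor (-1)) Ey1 _ ww _ => //; ring.
- by apply: (tor (-1)) Ey2 _ ww _ => //; ring.
- by apply: (tor (-1)) Ey3 _ ww _ => //; ring.
- by apply: (tor 0) Ez1 _ ww _ => //; ring.
- by apply: (tor 0) Ez2 _ ww _ => //; ring.
Qed.

Lemma addr_idem_eq0 (V : zmodType) (x : V) : x + x = x -> x = 0.
Proof. by move/(congr1 (+%R^~ (- x))); rewrite addrK subrr. Qed.

Lemma addr0_eqN (V : zmodType) (x y : V) : x + y = 0 -> x = - y.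
Proof. by move/eqP; rewrite addr_eq0 => /eqP. Qed.

Section OneDerivation.
Variable D : jac R -> jac R.
Hypothesis D_L : forall x, jlie x -> jlie (D x).
Hypothesis D_D : forall x y, jlie x -> jlie y -> D (x + y) = D x + D y.
Hypothesis D_br : forall x y, jlie x -> jlie y ->
  D (x * y - y * x) = D x * y - y * D x + (x * D y - D y * x).

Definition Dto t dt := D (ell t) = ell dt.

Lemma Dto_ex t : exists dt, Dto t dt.
Proof. by apply: D_L; exists t. Qed.

Lemma Dto_fun t dt dt' : Dto t dt -> Dto t dt' -> dt = dt'.
Proof. by move=> + E; rewrite /Dto E => /ell_inj. Qed.

Lemma Dto_D t dt t' dt' : Dto t dt -> Dto t' dt' -> Dto (t + t') (dt + dt').
Proof. by rewrite /Dto !ellD => <- <-; apply: D_D; [exists t | exists t']. Qed.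

Lemma Dto_0 : Dto 0 0.
Proof.
have [d d0] := Dto_ex 0; have dd := Dto_D d0 d0; rewrite addr0 in dd.
by have dE := addr_idem_eq0 (Dto_fun dd d0); rewrite dE in d0.
Qed.

Lemma Dto_Mn t dt n : Dto t dt -> Dto (t *+ n) (dt *+ n).
Proof.
move=> h; elim: n => [|n IH]; first exact: Dto_0.
by rewrite !mulrS; apply: Dto_D.
Qed.

Lemma Dto_Mz t dt w : Dto t dt -> Dto (t *~ w) (dt *~ w).
Proof.
move=> h; case: w => n; first exact: Dto_Mn.
rewrite NegzE !mulrNz -!pmulrn; have [d hd] := Dto_ex (- (t *+ n.+1)).
have hs := Dto_D hd (Dto_Mn n.+1 h); rewrite addNr in hs.
by have dE := addr0_eqN (Dto_fun hs Dto_0); rewrite dE in hd.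
Qed.

Lemma Dto_br t dt t' dt' : Dto t dt -> Dto t' dt' ->
  Dto (br t t') (br dt t' + br t dt').
Proof.
rewrite /Dto => h h'; rewrite ell_br D_br; [|by exists t|by exists t'].
by rewrite ellD !ell_br h h'.
Qed.

(** The ten coordinates that are read off, one for each dimension of the derivations: D h detects the
inner derivations by e, f, xi and yi, the coordinate on e of D e detects ad h, and
the coordinate on x1 of D x1 detects the grading. *)
Definition jprobe (j : 'I_10) : jac R :=
  ell (if (j < 8)%N then lie_h else if (j == 8 :> nat)%N then lie_e else lie_x1).

Definition jcoord (j : 'I_10) (u : jac R) : R :=
  let: (_, (_, g12, g21, _), _, ((x1, y1), (x2, y2), (x3, y3)), _) := u in
  nth 0 [:: g12; g21; x1; y1; x2; y2; x3; y3; g12; x1] j.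

Ltac lie_ring := congr (Lie _ _ _ _ _ _ _ _ _ _ _); ring.

Lemma br_central t z1 z2 : br (Lie 0 0 0 0 0 0 0 0 0 z1 z2) t = 0.
Proof. by elim/lieP: t => *; lie_ring. Qed.

Lemma lie_ind (P : lie R -> Prop) :
  P lie_h -> P lie_e -> P lie_f -> P lie_x1 -> P lie_y1 -> P lie_x2 -> P lie_y2 ->
  P lie_x3 -> P lie_y3 -> P lie_z1 -> P lie_z2 ->
  (forall t t', P t -> P t' -> P (t + t')) -> (forall t n, P t -> P (t *+ n)) ->
  forall t, P t.
Proof.
move=> Ph Pe Pf Px1 Py1 Px2 Py2 Px3 Py3 Pz1 Pz2 PD PM.
elim/lieP=> a b c x1 y1 x2 y2 x3 y3 z1 z2.
have PL u v w : P u -> P v -> w = u + v -> P w by move=> Pu Pv ->; apply: PD.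
have [na ->] := natR a.
apply: (PL (lie_h *+ na) (Lie 0 b c x1 y1 x2 y2 x3 y3 z1 z2));
  [exact: PM | | rewrite LieMn LieD; lie_ring].
have [nb ->] := natR b.
apply: (PL (lie_e *+ nb) (Lie 0 0 c x1 y1 x2 y2 x3 y3 z1 z2));
  [exact: PM | | rewrite LieMn LieD; lie_ring].
have [nc ->] := natR c.
apply: (PL (lie_f *+ nc) (Lie 0 0 0 x1 y1 x2 y2 x3 y3 z1 z2));
  [exact: PM | | rewrite LieMn LieD; lie_ring].
have [nx1 ->] := natR x1.
apply: (PL (lie_x1 *+ nx1) (Lie 0 0 0 0 y1 x2 y2 x3 y3 z1 z2));
  [exact: PM | | rewrite LieMn LieD; lie_ring].
have [ny1 ->] := natR y1.
apply: (PL (lie_y1 *+ ny1) (Lie 0 0 0 0 0 x2 y2 x3 y3 z1 z2));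
  [exact: PM | | rewrite LieMn LieD; lie_ring].
have [nx2 ->] := natR x2.
apply: (PL (lie_x2 *+ nx2) (Lie 0 0 0 0 0 0 y2 x3 y3 z1 z2));
  [exact: PM | | rewrite LieMn LieD; lie_ring].
have [ny2 ->] := natR y2.
apply: (PL (lie_y2 *+ ny2) (Lie 0 0 0 0 0 0 0 x3 y3 z1 z2));
  [exact: PM | | rewrite LieMn LieD; lie_ring].
have [nx3 ->] := natR x3.
apply: (PL (lie_x3 *+ nx3) (Lie 0 0 0 0 0 0 0 0 y3 z1 z2));
  [exact: PM | | rewrite LieMn LieD; lie_ring].
have [ny3 ->] := natR y3.
apply: (PL (lie_y3 *+ ny3) (Lie 0 0 0 0 0 0 0 0 0 z1 z2));
  [exact: PM | | rewrite LieMn LieD; lie_ring].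
have [nz1 ->] := natR z1.
apply: (PL (lie_z1 *+ nz1) (Lie 0 0 0 0 0 0 0 0 0 0 z2));
  [exact: PM | | rewrite LieMn LieD; lie_ring].
have [nz2 ->] := natR z2.
rewrite (_ : Lie _ _ _ _ _ _ _ _ _ _ _ = lie_z2 *+ nz2); first exact: PM.
by rewrite LieMn; lie_ring.
Qed.

Lemma tors12_eq k (x y z : R) : y = z -> x *+ 12 = (y - z) *+ k -> tors12 x.
Proof. by move=> ->; rewrite subrr mul0rn. Qed.

Lemma Dto_rel t dt t' dt' u du : Dto t dt -> Dto t' dt' -> Dto u du -> br t t' = u ->
  br dt t' + br t dt' = du.
Proof. by move=> h h' hu E; apply: (Dto_fun (Dto_br h h')); rewrite E. Qed.

(** With these coordinates zero, [h, x1] = x1 shows that D h is central, so D preserves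
weights up to 12-torsion.  From [e, f] = h one gets D h = 0 and no component of D f
on f, and [e, yi] = xi shows that the xi and yi components of D are given by one
matrix M.  The relations [xi, yj] = 0 for i <> j make M diagonal, and
[x3, y3] = [x1, y1] + [x2, y2] makes its entries equal, thus zero since M11 = 0;
every step holds up to torsion killed by 12. *)
Lemma derivation_torsion : (forall j, jcoord j (D (jprobe j)) = 0) ->
  forall t dt, Dto t dt -> tors12 dt.
Proof.
move=> vanish.
have [dh] := Dto_ex lie_h;
  elim/lieP: dh => ah bh ch x1h y1h x2h y2h x3h y3h z1h z2h Dh.
have [de] := Dto_ex lie_e;
  elim/lieP: de => ae be ce x1e y1e x2e y2e x3e y3e z1e z2e De.
have [df] := Dto_ex lie_f;
  elim/lieP: df => af bf cf x1f y1f x2f y2f x3f y3f z1f z2f Df.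
have [dX1] := Dto_ex lie_x1;
  elim/lieP: dX1 => aX1 bX1 cX1 x1X1 y1X1 x2X1 y2X1 x3X1 y3X1 z1X1 z2X1 DX1.
have [dY1] := Dto_ex lie_y1;
  elim/lieP: dY1 => aY1 bY1 cY1 x1Y1 y1Y1 x2Y1 y2Y1 x3Y1 y3Y1 z1Y1 z2Y1 DY1.
have [dX2] := Dto_ex lie_x2;
  elim/lieP: dX2 => aX2 bX2 cX2 x1X2 y1X2 x2X2 y2X2 x3X2 y3X2 z1X2 z2X2 DX2.
have [dY2] := Dto_ex lie_y2;
  elim/lieP: dY2 => aY2 bY2 cY2 x1Y2 y1Y2 x2Y2 y2Y2 x3Y2 y3Y2 z1Y2 z2Y2 DY2.
have [dX3] := Dto_ex lie_x3;
  elim/lieP: dX3 => aX3 bX3 cX3 x1X3 y1X3 x2X3 y2X3 x3X3 y3X3 z1X3 z2X3 DX3.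
have [dY3] := Dto_ex lie_y3;
  elim/lieP: dY3 => aY3 bY3 cY3 x1Y3 y1Y3 x2Y3 y2Y3 x3Y3 y3Y3 z1Y3 z2Y3 DY3.
have [dZ1] := Dto_ex lie_z1;
  elim/lieP: dZ1 => aZ1 bZ1 cZ1 x1Z1 y1Z1 x2Z1 y2Z1 x3Z1 y3Z1 z1Z1 z2Z1 DZ1.
have [dZ2] := Dto_ex lie_z2;
  elim/lieP: dZ2 => aZ2 bZ2 cZ2 x1Z2 y1Z2 x2Z2 y2Z2 x3Z2 y3Z2 z1Z2 z2Z2 DZ2.
have bh0 : bh = 0 by have := vanish (Ordinal (isT : (0 < 10)%N)); rewrite Dh.
have ch0 : ch = 0 by have := vanish (Ordinal (isT : (1 < 10)%N)); rewrite Dh.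
have x1h0 : x1h = 0 by have := vanish (Ordinal (isT : (2 < 10)%N)); rewrite Dh.
have y1h0 : y1h = 0 by have := vanish (Ordinal (isT : (3 < 10)%N)); rewrite Dh.
have x2h0 : x2h = 0 by have := vanish (Ordinal (isT : (4 < 10)%N)); rewrite Dh.
have y2h0 : y2h = 0 by have := vanish (Ordinal (isT : (5 < 10)%N)); rewrite Dh.
have x3h0 : x3h = 0 by have := vanish (Ordinal (isT : (6 < 10)%N)); rewrite Dh.
have y3h0 : y3h = 0 by have := vanish (Ordinal (isT : (7 < 10)%N)); rewrite Dh.
have be0 : be = 0 by have := vanish (Ordinal (isT : (8 < 10)%N)); rewrite De.
have x1X10 : x1X1 = 0 by have := vanish (Ordinal (isT : (9 < 10)%N)); rewrite DX1.
subst bh ch x1h y1h x2h y2h x3h y3h be x1X1.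
have hw (w : int) u du : Dto u du -> br lie_h u = u *~ w ->
    br (Lie ah 0 0 0 0 0 0 0 0 z1h z2h) u + br lie_h du = du *~ w.
  move=> Du uw; apply: Dto_fun (Dto_br Dh Du) _.
  by rewrite uw; apply: Dto_Mz.
have he : br lie_h lie_e = lie_e *~ (2) by rewrite LieMz; lie_ring.
have hf : br lie_h lie_f = lie_f *~ (-2) by rewrite LieMz; lie_ring.
have hX1 : br lie_h lie_x1 = lie_x1 *~ (1) by rewrite LieMz; lie_ring.
have hY1 : br lie_h lie_y1 = lie_y1 *~ (-1) by rewrite LieMz; lie_ring.
have hX2 : br lie_h lie_x2 = lie_x2 *~ (1) by rewrite LieMz; lie_ring.
have hY2 : br lie_h lie_y2 = lie_y2 *~ (-1) by rewrite LieMz; lie_ring.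
have hX3 : br lie_h lie_x3 = lie_x3 *~ (1) by rewrite LieMz; lie_ring.
have hY3 : br lie_h lie_y3 = lie_y3 *~ (-1) by rewrite LieMz; lie_ring.
have hZ1 : br lie_h lie_z1 = lie_z1 *~ (0) by rewrite LieMz; lie_ring.
have hZ2 : br lie_h lie_z2 = lie_z2 *~ (0) by rewrite LieMz; lie_ring.
have ah0 : ah = 0.
  have := hw 1 _ _ DX1 hX1; rewrite LieMz /= LieD; case=> _ _ _ E _ _ _ _ _ _ _.
  by apply: eq_of_sub E; ring.
subst ah.
have W (w : int) u a b c x1 y1 x2 y2 x3 y3 z1 z2 :
    Dto u (Lie a b c x1 y1 x2 y2 x3 y3 z1 z2) -> br lie_h u = u *~ w ->
    (`|w| <= 2)%N -> _ := fun Du uw w2 => weight_torsion w2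
      (etrans (esym (etrans (congr1 (+%R^~ _) (br_central u z1h z2h)) (add0r _)))
      (hw w u _ Du uw)).
have [[Tae Tbe Tce] [[Tx1e Tx2e Tx3e] [[Ty1e Ty2e Ty3e] [Tz1e Tz2e]]]] :=
  W _ _ _ _ _ _ _ _ _ _ _ _ _ De he isT.
have [[Taf Tbf Tcf] [[Tx1f Tx2f Tx3f] [[Ty1f Ty2f Ty3f] [Tz1f Tz2f]]]] :=
  W _ _ _ _ _ _ _ _ _ _ _ _ _ Df hf isT.
have [[TaX1 TbX1 TcX1] [[Tx1X1 Tx2X1 Tx3X1] [[Ty1X1 Ty2X1 Ty3X1] [Tz1X1 Tz2X1]]]] :=
  W _ _ _ _ _ _ _ _ _ _ _ _ _ DX1 hX1 isT.
have [[TaY1 TbY1 TcY1] [[Tx1Y1 Tx2Y1 Tx3Y1] [[Ty1Y1 Ty2Y1 Ty3Y1] [Tz1Y1 Tz2Y1]]]] :=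
  W _ _ _ _ _ _ _ _ _ _ _ _ _ DY1 hY1 isT.
have [[TaX2 TbX2 TcX2] [[Tx1X2 Tx2X2 Tx3X2] [[Ty1X2 Ty2X2 Ty3X2] [Tz1X2 Tz2X2]]]] :=
  W _ _ _ _ _ _ _ _ _ _ _ _ _ DX2 hX2 isT.
have [[TaY2 TbY2 TcY2] [[Tx1Y2 Tx2Y2 Tx3Y2] [[Ty1Y2 Ty2Y2 Ty3Y2] [Tz1Y2 Tz2Y2]]]] :=
  W _ _ _ _ _ _ _ _ _ _ _ _ _ DY2 hY2 isT.
have [[TaX3 TbX3 TcX3] [[Tx1X3 Tx2X3 Tx3X3] [[Ty1X3 Ty2X3 Ty3X3] [Tz1X3 Tz2X3]]]] :=
  W _ _ _ _ _ _ _ _ _ _ _ _ _ DX3 hX3 isT.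
have [[TaY3 TbY3 TcY3] [[Tx1Y3 Tx2Y3 Tx3Y3] [[Ty1Y3 Ty2Y3 Ty3Y3] [Tz1Y3 Tz2Y3]]]] :=
  W _ _ _ _ _ _ _ _ _ _ _ _ _ DY3 hY3 isT.
have [[TaZ1 TbZ1 TcZ1] [[Tx1Z1 Tx2Z1 Tx3Z1] [[Ty1Z1 Ty2Z1 Ty3Z1] [Tz1Z1 Tz2Z1]]]] :=
  W _ _ _ _ _ _ _ _ _ _ _ _ _ DZ1 hZ1 isT.
have [[TaZ2 TbZ2 TcZ2] [[Tx1Z2 Tx2Z2 Tx3Z2] [[Ty1Z2 Ty2Z2 Ty3Z2] [Tz1Z2 Tz2Z2]]]] :=
  W _ _ _ _ _ _ _ _ _ _ _ _ _ DZ2 hZ2 isT.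
have [cf0 z1h0 z2h0] : [/\ cf = 0, z1h = 0 & z2h = 0].
  have E : br lie_e lie_f = lie_h by rewrite ?LieMn ?LieD; lie_ring.
  have := Dto_rel De Df Dh E;
    rewrite ?LieMn ?LieD => -[Ea _ _ _ _ _ _ _ _ Ez1 Ez2].
  split.
  - by apply: eq_of_sub Ea; ring.
  - by apply/esym; apply: eq_of_sub Ez1; ring.
  - by apply/esym; apply: eq_of_sub Ez2; ring.
have [e11 e12 e13] : [/\ y1Y1 = 0, y2Y1 = x2X1 & y3Y1 = x3X1].
  have E : br lie_e lie_y1 = lie_x1 by rewrite ?LieMn ?LieD; lie_ring.
  have := Dto_rel De DY1 DX1 E;
    rewrite ?LieMn ?LieD => -[_ _ _ Ex1 _ Ex2 _ Ex3 _ _ _].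
  split.
  - by apply: eq_of_sub Ex1; ring.
  - by apply: eq_of_sub Ex2; ring.
  - by apply: eq_of_sub Ex3; ring.
have [e21 e22 e23] : [/\ y1Y2 = x1X2, y2Y2 = x2X2 & y3Y2 = x3X2].
  have E : br lie_e lie_y2 = lie_x2 by rewrite ?LieMn ?LieD; lie_ring.
  have := Dto_rel De DY2 DX2 E;
    rewrite ?LieMn ?LieD => -[_ _ _ Ex1 _ Ex2 _ Ex3 _ _ _].
  split.
  - by apply: eq_of_sub Ex1; ring.
  - by apply: eq_of_sub Ex2; ring.
  - by apply: eq_of_sub Ex3; ring.
have [e31 e32 e33] : [/\ y1Y3 = x1X3, y2Y3 = x2X3 & y3Y3 = x3X3].
  have E : br lie_e lie_y3 = lie_x3 by rewrite ?LieMn ?LieD; lie_ring.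
  have := Dto_rel De DY3 DX3 E;
    rewrite ?LieMn ?LieD => -[_ _ _ Ex1 _ Ex2 _ Ex3 _ _ _].
  split.
  - by apply: eq_of_sub Ex1; ring.
  - by apply: eq_of_sub Ex2; ring.
  - by apply: eq_of_sub Ex3; ring.
subst z1h z2h cf y1Y1 y2Y1 y3Y1 y1Y2 y2Y2 y3Y2 y1Y3 y2Y3 y3Y3.
(* off-diagonal entries of M; [xi, yj] carries a factor 2, hence k = 6 *)
have [m21 m12] : tors12 x1X2 /\ tors12 x2X1.
  have E : br lie_x1 lie_y2 = 0 by lie_ring.
  have := Dto_rel DX1 DY2 Dto_0 E;
    rewrite ?LieMn ?LieD => -[_ _ _ _ _ _ _ _ _ Ez1 Ez2].
  split.
  - by apply: (tors12_eq (k := 6) Ez1); ring.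
  - by apply: (tors12_eq (k := 6) Ez2); ring.
have [m31_ m13] : tors12 (x1X3 + x3X1) /\ tors12 x3X1.
  have E : br lie_x1 lie_y3 = 0 by lie_ring.
  have := Dto_rel DX1 DY3 Dto_0 E;
    rewrite ?LieMn ?LieD => -[_ _ _ _ _ _ _ _ _ Ez1 Ez2].
  split.
  - by apply: (tors12_eq (k := 6) Ez1); ring.
  - by apply: (tors12_eq (k := 6) Ez2); ring.
have [m23 m32_] : tors12 x3X2 /\ tors12 (x2X3 + x3X2).
  have E : br lie_x2 lie_y3 = 0 by lie_ring.
  have := Dto_rel DX2 DY3 Dto_0 E;
    rewrite ?LieMn ?LieD => -[_ _ _ _ _ _ _ _ _ Ez1 Ez2].
  split.
  - by apply: (tors12_eq (k := 6) Ez1); ring.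
  - by apply: (tors12_eq (k := 6) Ez2); ring.
have m31 : tors12 x1X3 by move: m31_; rewrite /tors12 mulrnDl m13 addr0.
have m32 : tors12 x2X3 by move: m32_; rewrite /tors12 mulrnDl m23 addr0.
(* diagonal entries, through the action of D on the centre *)
have [aZ1_ z11 z21] : [/\ 0 = aZ1 *+ 2, 0 = z1Z1 *+ 2 & 0 = z2Z1 *+ 2].
  have E : br lie_x1 lie_y1 = lie_z1 *+ 2 by rewrite ?LieMn ?LieD; lie_ring.
  have := Dto_rel DX1 DY1 (Dto_Mn 2 DZ1) E;
    rewrite ?LieMn ?LieD => -[Ea _ _ _ _ _ _ _ _ Ez1 Ez2].
  split.
  - by apply: eq_of_sub Ea; ring.
  - by apply: eq_of_sub Ez1; ring.
  - by apply: eq_of_sub Ez2; ring.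
have [aZ2_ z12 z22] : [/\ 0 = aZ2 *+ 2, 0 = z1Z2 *+ 2 & x2X2 *+ 4 = z2Z2 *+ 2].
  have E : br lie_x2 lie_y2 = lie_z2 *+ 2 by rewrite ?LieMn ?LieD; lie_ring.
  have := Dto_rel DX2 DY2 (Dto_Mn 2 DZ2) E;
    rewrite ?LieMn ?LieD => -[Ea _ _ _ _ _ _ _ _ Ez1 Ez2].
  split.
  - by apply: eq_of_sub Ea; ring.
  - by apply: eq_of_sub Ez1; ring.
  - by apply: eq_of_sub Ez2; ring.
have [e331 e332] : x3X3 *+ 4 = z1Z1 *+ 2 + z1Z2 *+ 2 /\ x3X3 *+ 4 = z2Z1 *+ 2 + z2Z2 *+ 2.
  have E : br lie_x3 lie_y3 = lie_z1 *+ 2 + lie_z2 *+ 2 by rewrite ?LieMn ?LieD; lie_ring.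
  have := Dto_rel DX3 DY3 (Dto_D (Dto_Mn 2 DZ1) (Dto_Mn 2 DZ2)) E;
    rewrite ?LieMn ?LieD => -[_ _ _ _ _ _ _ _ _ Ez1 Ez2].
  split.
  - by apply: eq_of_sub Ez1; ring.
  - by apply: eq_of_sub Ez2; ring.
rewrite -z11 -z12 addr0 in e331; rewrite -z21 add0r e331 in e332.
rewrite -e332 in z22.
have dbl (x : R) : 0 = x *+ 2 -> tors12 x.
  by move=> x2; rewrite /tors12 (mulrnA x 2 6) -x2 mul0rn.
have qdr (x : R) : x *+ 4 = 0 -> tors12 x.
  by move=> x4; rewrite /tors12 (mulrnA x 4 3) x4 mul0rn.
have T0 : tors12 (0 : R) by rewrite /tors12 mul0rn.
have conclude u du : Dto u du -> tors12 du -> forall dt, Dto u dt -> tors12 dt.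
  by move=> hu Tu dt h; rewrite (Dto_fun h hu).
apply: lie_ind.
- apply: conclude Dh _.
  exact: (tors12_Lie T0 T0 T0 T0 T0 T0 T0 T0 T0 T0 T0).
- apply: conclude De _.
  exact: (tors12_Lie (Tae isT) T0 (Tce isT) (Tx1e isT) (Ty1e isT) (Tx2e isT)
    (Ty2e isT) (Tx3e isT) (Ty3e isT) (Tz1e isT) (Tz2e isT)).
- apply: conclude Df _.
  exact: (tors12_Lie (Taf isT) (Tbf isT) T0 (Tx1f isT) (Ty1f isT) (Tx2f isT)
    (Ty2f isT) (Tx3f isT) (Ty3f isT) (Tz1f isT) (Tz2f isT)).
- apply: conclude DX1 _.
  exact: (tors12_Lie (TaX1 isT) (TbX1 isT) (TcX1 isT) T0 (Ty1X1 isT) m12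
    (Ty2X1 isT) m13 (Ty3X1 isT) (Tz1X1 isT) (Tz2X1 isT)).
- apply: conclude DY1 _.
  exact: (tors12_Lie (TaY1 isT) (TbY1 isT) (TcY1 isT) (Tx1Y1 isT) T0
    (Tx2Y1 isT) m12 (Tx3Y1 isT) m13 (Tz1Y1 isT) (Tz2Y1 isT)).
- apply: conclude DX2 _.
  exact: (tors12_Lie (TaX2 isT) (TbX2 isT) (TcX2 isT) m21 (Ty1X2 isT) (qdr _ z22)
    (Ty2X2 isT) m23 (Ty3X2 isT) (Tz1X2 isT) (Tz2X2 isT)).
- apply: conclude DY2 _.
  exact: (tors12_Lie (TaY2 isT) (TbY2 isT) (TcY2 isT) (Tx1Y2 isT) m21
    (Tx2Y2 isT) (qdr _ z22) (Tx3Y2 isT) m23 (Tz1Y2 isT) (Tz2Y2 isT)).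
- apply: conclude DX3 _.
  exact: (tors12_Lie (TaX3 isT) (TbX3 isT) (TcX3 isT) m31 (Ty1X3 isT) m32
    (Ty2X3 isT) (qdr _ e331) (Ty3X3 isT) (Tz1X3 isT) (Tz2X3 isT)).
- apply: conclude DY3 _.
  exact: (tors12_Lie (TaY3 isT) (TbY3 isT) (TcY3 isT) (Tx1Y3 isT) m31
    (Tx2Y3 isT) m32 (Tx3Y3 isT) (qdr _ e331) (Tz1Y3 isT) (Tz2Y3 isT)).
- apply: conclude DZ1 _.
  exact: (tors12_Lie (dbl _ aZ1_) (TbZ1 isT) (TcZ1 isT) (Tx1Z1 isT) (Ty1Z1 isT)
    (Tx2Z1 isT) (Ty2Z1 isT) (Tx3Z1 isT) (Ty3Z1 isT) (dbl _ z11) (dbl _ z21)).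
- apply: conclude DZ2 _.
  exact: (tors12_Lie (dbl _ aZ2_) (TbZ2 isT) (TcZ2 isT) (Tx1Z2 isT) (Ty1Z2 isT)
    (Tx2Z2 isT) (Ty2Z2 isT) (Tx3Z2 isT) (Ty3Z2 isT) (dbl _ z12) (dbl _ e332)).
- move=> t t' Ht Ht'; have [[d hd] [d' hd']] := (Dto_ex t, Dto_ex t').
  apply: conclude (Dto_D hd hd') _.
  by rewrite /tors12 mulrnDl Ht // Ht' // addr0.
- move=> t n Ht; have [d hd] := Dto_ex t.
  apply: conclude (Dto_Mn n hd) _.
  by rewrite /tors12 mulrnAC Ht // mul0rn.
Qed.

End OneDerivation.
End Derivations.

(** * Residues modulo p^e *)

Section Residues.
Variables (p e : nat).
Hypothesis p_pr : prime p.
Hypothesis e_gt0 : (0 < e)%N.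
Local Notation R := 'Z_(p ^ e).

Let q_gt1 : (1 < p ^ e)%N.
Proof. by rewrite -{1}(exp1n e) ltn_exp2r // prime_gt1. Qed.

Lemma Zpe_nat (x : R) : exists n, x = n%:R.
Proof. by exists (x : nat); rewrite natr_Zp. Qed.

Lemma Zpe_eq0 n : (n%:R == 0 :> R) = (p ^ e %| n)%N.
Proof.
by rewrite -(inj_eq val_inj) /= val_Zp_nat.
Qed.

Lemma Zpe_exp (x : R) : x *+ p ^ e = 0.
Proof.
by have [n ->] := Zpe_nat x; rewrite -mulrnA; apply/eqP; rewrite Zpe_eq0 dvdn_mull.
Qed.

Lemma Zpe_tors k (x : R) : (k <= e)%N -> x *+ p ^ k = 0 -> pdvd p (e - k) x.
Proof.
move=> ke; have [n ->] := Zpe_nat x; rewrite -mulrnA => /eqP; rewrite Zpe_eq0.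
rewrite -{1}(subnK ke) expnD dvdn_pmul2r ?expn_gt0 ?prime_gt0 // => /dvdnP[m ->].
by exists m%:R; rewrite mulrnA.
Qed.

Lemma card_Zpe_tors : (#|[set x : R | x *+ p == 0%R]| <= p)%N.
Proof.
pose f (i : 'I_p) : R := (i * p ^ e.-1)%:R.
have /subset_leq_card : [set x : R | x *+ p == 0%R] \subset f @: 'I_p.
  apply/subsetP => x; rewrite inE -[X in _ *+ X]expn1 => /eqP /Zpe_tors[] // y ->.
  have [n ->] := Zpe_nat y; apply/imsetP; exists (Ordinal (ltn_pmod n (prime_gt0 p_pr))) => //.
  rewrite subn1 -mulrnA /f /=; apply/eqP; rewrite {1}(divn_eq n p) mulnDl natrD.
  rewrite -[X in _ == X]add0r (inj_eq (addIr _)) Zpe_eq0 -mulnA -expnS prednK //.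
  exact: dvdn_mull.
by move/leq_trans; apply; rewrite (leq_trans (leq_imset_card _ _)) ?card_ord.
Qed.

Lemma Zpe_inj b (i j : 'I_(p ^ (e - b))) : (b <= e)%N ->
  i%:R *+ p ^ b = j%:R *+ p ^ b :> R -> i = j.
Proof.
move=> be; rewrite -!mulrnA => /(congr1 val); rewrite /= !val_Zp_nat //.
have small (k : 'I_(p ^ (e - b))) : (k * p ^ b < p ^ e)%N.
  by rewrite -[X in (_ < _ ^ X)%N](subnK be) expnD ltn_pmul2r ?expn_gt0 ?prime_gt0.
rewrite !modn_small // => /eqP; rewrite eqn_pmul2r ?expn_gt0 ?prime_gt0 // => /eqP.
exact: val_inj.
Qed.

End Residues.

Lemma tors_gcd (V : zmodType) (x : V) m n :
  x *+ m = 0 -> x *+ n = 0 -> x *+ gcdn m n = 0.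
Proof.
have [->|m0] := posnP m; first by rewrite gcd0n.
move=> xm xn; have [km kn E _] := egcdnP n m0.
have : x *+ (km * m) = x *+ (kn * n + gcdn m n) by rewrite E.
by rewrite mulrnDr !(mulnC _ m) !(mulnC _ n) !mulrnA xm xn !mul0rn add0r.
Qed.

(** This fixes the precision: for p = 2, the factor 4 of 12 makes r = 3 the least r such
that 12-torsion killed by p^r is killed by p^(r-1). *)
Lemma gcd12_prime_cube p : prime p -> (gcdn 12 (p ^ 3) %| p ^ 2)%N.
Proof.
move=> p_pr; have [p12|np12] := boolP (p %| 12)%N; last first.
  have -> : gcdn 12 (p ^ 3) = 1%N; last exact: dvd1n.
  by apply/eqP; rewrite -/(coprime _ _) coprimeXr // coprime_sym prime_coprime.
have: p \in primes 12 by rewrite mem_primes p_pr.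
by rewrite (_ : primes 12 = [:: 2; 3]%N) // !inE => /orP[] /eqP ->.
Qed.

(** * The family of groups *)

Section Chart.
Variable R : finComNzRingType.

Lemma jcoordD j (u v : jac R) : jcoord j (u + v) = jcoord j u + jcoord j v.
Proof.
elim/jacP: u => s g11 g12 g21 g22 a1 b1 a2 b2 a3 b3 x1 y1 x2 y2 x3 y3 z1 z2.
elim/jacP: v => s' h11 h12 h21 h22 a1' b1' a2' b2' a3' b3' x1' y1' x2' y2' x3' y3' z1' z2'.
rewrite JacD; case: j => j /=.
by do 10!case: j => [|j] //.
Qed.

Lemma jlie_probe j : jlie (jprobe R j).
Proof. by eexists. Qed.

Lemma jlieD (x y : jac R) : jlie x -> jlie y -> jlie (x + y).
Proof. by case=> t -> [t' ->]; exists (t + t'); rewrite ellD. Qed.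

Lemma jlieMn (x : jac R) n : jlie x -> jlie (x *+ n).
Proof. by case=> t ->; exists (t *+ n); rewrite ellMn. Qed.

Lemma jlie_br (x y : jac R) : jlie x -> jlie y -> jlie (x * y - y * x).
Proof. by case=> t -> [t' ->]; exists (br t t'); rewrite ell_br. Qed.

Lemma card_jac_tors p (K := [set x : R | x *+ p == 0%R]) :
  (#|[set x : jac R | x *+ p == 0%R]| <= #|K| ^ 19)%N.
Proof.
pose P2 := setX K K; pose P4 := setX (setX P2 K) K; pose P6 := setX (setX P2 P2) P2.
have /subset_leq_card : [set x : jac R | x *+ p == 0%R] \subset
    setX (setX (setX (setX K P4) P6) P6) P2.
  apply/subsetP; elim/jacP=> s g11 g12 g21 g22 a1 b1 a2 b2 a3 b3 x1 y1 x2 y2 x3 y3 z1 z2.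
  by rewrite inE JacMn => /eqP[*]; rewrite !inE /=; do !(apply/andP; split); apply/eqP.
move/leq_trans; apply; rewrite !cardsX.
by move: #|K| => k; apply: eq_leq; rewrite !expnS expn0 muln1 !mulnA.
Qed.

End Chart.

Section Family.
Variables (p : nat) (p_pr : prime p) (n : nat).

Let r := 3%N.
Let b := r.+1.
Definition modulus_exp := (b + b + r + r + n)%N.
Local Notation e := modulus_exp.
Local Notation R := 'Z_(p ^ e).

Let e_gt0 : (0 < e)%N. Proof. by []. Qed.
Let expR := Zpe_exp p_pr e_gt0.
Let torsR := @Zpe_tors p e p_pr e_gt0.

Definition small_aut_group := jcong_group p e R b.
Local Notation U := small_aut_group.

Let U_base u : u \in U -> pdvd p b (val u - 1).
Proof.
rewrite inE => /andP[_ du].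
by apply/(pdvdP (expJ expR) (torsJ torsR)) => //; rewrite /modulus_exp /b /r; lia.
Qed.

Lemma jlie_derivation_tors (D : jac R -> jac R) :
  (forall x, jlie x -> jlie (D x)) ->
  (forall x y, jlie x -> jlie y -> D (x + y) = D x + D y) ->
  (forall x y, jlie x -> jlie y ->
     D (x * y - y * x) = D x * y - y * D x + (x * D y - D y * x)) ->
  (forall x, jlie x -> D x *+ p ^ r = 0) ->
  (forall j, jcoord j (D (jprobe R j)) = 0) ->
  forall x, jlie x -> D x *+ p ^ r.-1 = 0.
Proof.
move=> D_L D_D D_br D_r D_probe x Lx; have D12 : D x *+ 12 = 0.
  case: Lx => t ->; have [dt Dt] := Dto_ex D_L t.
  have /= := derivation_torsion (@Zpe_nat p e) D_L D_D D_br D_probe Dt.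
  by rewrite Dt -ellMn /tors12 => ->; rewrite -(mulr0n (Lie 0 0 0 0 0 0 0 0 0 0 0)) ellMn.
have /dvdnP[k ->] := gcd12_prime_cube p_pr.
by rewrite mulnC mulrnA tors_gcd ?mul0rn // D_r.
Qed.

(** A bound for C that depends on p only: the p-torsion of the matrix ring, which has
rank 19, has order at most p^19. *)
Definition aut_const := (((p ^ 19) ^ (p ^ 19)) ^ (r + (r + r)) * p ^ 10)%N.

Lemma card_Aut_small : (#|Aut U| <= aut_const * p ^ (10 * n))%N.
Proof.
have := @card_Aut_le p e r (jac R) p_pr isT (expJ expR) (torsJ torsR) U (@jlie R)
  U_base (@jlieD R) (@jlieMn R) (@jlie_br R) _ _ 10 _ _ (@jcoord R) (@jcoordD R)
  (@jlie_probe R) (card_Zpe_tors p_pr e_gt0) jlie_derivation_tors n erefl.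
move=> bound; apply: leq_trans (bound _ _) _.
- by move=> k u; apply: jcong_tangent.
- by move=> x; apply: (jcong_lift expR torsR).
set t := #|_|; have tp : (t <= p ^ 19)%N.
  apply: leq_trans (card_jac_tors _ _) _.
  by rewrite leq_exp2r //; apply: card_Zpe_tors.
clearbody t; have p19 : (0 < p ^ 19)%N by rewrite expn_gt0 prime_gt0.
have tt : (t ^ t <= (p ^ 19) ^ (p ^ 19))%N.
  apply: leq_trans (leq_pexp2l p19 tp).
  by have [->|t0] := posnP t; [rewrite !expn0 | rewrite leq_exp2r].
rewrite /aut_const -mulnA; apply: leq_mul; first by rewrite leq_exp2r.
by rewrite -expnM mulnS expnD.
Qed.

Lemma card_small_ge : (p ^ (11 * n) <= #|U|)%N.
Proof.
pose N := (p ^ (e - b))%N.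
pose img (t : lie 'I_N) : lie R :=
  let: ((a, b, c), ((x1, y1), (x2, y2), (x3, y3)), (z1, z2)) := t in
  Lie a%:R b%:R c%:R x1%:R y1%:R x2%:R y2%:R x3%:R y3%:R z1%:R z2%:R.
have be : (b <= e)%N by rewrite /modulus_exp /b /r; lia.
have img_inj t t' : img t *+ p ^ b = img t' *+ p ^ b -> t = t'.
  elim/lieP: t => a b' c x1 y1 x2 y2 x3 y3 z1 z2.
  elim/lieP: t' => a2 b2 c2 x12 y12 x22 y22 x32 y32 z12 z22.
  rewrite /img /= !LieMn => -[].
  do 11!move=> /(Zpe_inj p_pr e_gt0 be) ->.
  by [].
pose f t := odflt 1%g [pick u in U | jchart (val u) == img t *+ p ^ b].
have fP t : f t \in U /\ jchart (val (f t)) = img t *+ p ^ b.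
  rewrite /f; case: pickP => [u /andP[uU /eqP]//|none].
  have [u uU [ut _]] := jcong_param expR torsR (isT : (0 < b)%N) (img t).
  by have := none u; rewrite /= uU ut eqxx.
have f_inj : injective f.
  by move=> t t' ff; apply: img_inj; rewrite -!(fP _).2 ff.
apply: (@leq_trans #|{: lie 'I_N}|).
  rewrite /lie !card_prod card_ord /N -!expnD leq_exp2l ?prime_gt1 //.
  by rewrite /modulus_exp /b /r; lia.
rewrite -(card_imset _ f_inj); apply: subset_leq_card.
by apply/subsetP => _ /imsetP[t _ ->]; apply: (fP t).1.
Qed.

Lemma small_pgroup : p.-group U.
Proof. exact: (U_pgroup p_pr (expJ expR) U_base). Qed.

(** Units tangent to e and f have a commutator tangent to h, which is not 0. *)
Lemma small_nonabelian : ~~ abelian U.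
Proof.
have Le t : jlie (ell t : jac R) by exists t.
have [u uU du] := jcong_lift expR torsR (isT : (0 < b)%N) (Le (lie_e R)).
have [v vU dv] := jcong_lift expR torsR (isT : (0 < b)%N) (Le (lie_f R)).
apply/negP => /centsP/(_ u uU v vU) uv.
have := commutator_cong U_base uU vU du dv.
rewrite uv; cbv zeta; rewrite mulgV FinRing.val_unit1 subrr sub0r -ell_br.
have -> : br (lie_e R) (lie_f R) = lie_h R.
  by congr (Lie _ _ _ _ _ _ _ _ _ _ _); ring.
move=> /pdvdN; rewrite opprK => -[w].
elim/jacP: w => s g11 g12 g21 g22 a1 b1 a2 b2 a3 b3 x1 y1 x2 y2 x3 y3 z1 z2.
rewrite /ell /= !JacMn => -[_ E _ _ _ _ _ _ _ _ _ _ _ _ _ _ _ _ _].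
have /eqP : (p ^ (e - b))%:R = 0 :> R.
  have -> : (e - b = b + b + (e - (b + b + b)))%N by rewrite /modulus_exp /b /r; lia.
  rewrite expnD mulrnA E -mulrnA -expnD.
  rewrite (_ : r.+1 + r.+1 + r.+1 + _ = e)%N; first exact: expR.
  by rewrite /modulus_exp /b /r; lia.
rewrite Zpe_eq0 // dvdn_Pexp2l ?prime_gt1 //.
by rewrite /modulus_exp /b /r; lia.
Qed.

Lemma small_aut_group_spec : [/\ p.-group U, (p ^ (11 * n) <= #|U|)%N,
   (#|Aut U| <= aut_const * p ^ (10 * n))%N & ~~ abelian U].
Proof.
by split; [exact: small_pgroup | exact: card_small_ge | exact: card_Aut_small
  | exact: small_nonabelian].
Qed.

End Family.

(** * The asymptotic statement *)

From mathcomp Require Import all_classical all_reals all_analysis.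
Import numFieldNormedType.Exports.
Local Open Scope classical_set_scope.
Local Open Scope ring_scope.

(** 41 * 10 <= 40 * 11. *)
Lemma aut_ratio_le (R : realType) (p : nat) (C n a u : nat) : (1 < p)%N ->
  (p ^ (11 * n) <= u)%N -> (a <= C * p ^ (10 * n))%N ->
  (a%:R / (u%:R `^ (40%:R / 41%:R)) : R) <= C%:R.
Proof.
move=> p1 un aC; have p0 : (0 < p%:R :> R) by rewrite ltr0n ltnW.
have u0 : (0 < u)%N by apply: leq_trans un; rewrite expn_gt0 ltnW.
have up : 0 < (u%:R : R) `^ (40%:R / 41%:R) by rewrite powR_gt0 // ltr0n.
rewrite ler_pdivrMr //; apply: (@le_trans _ _ (C%:R * p%:R ^+ (10 * n))).
  by rewrite -natrX -natrM ler_nat.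
rewrite ler_wpM2l //; apply: (@le_trans _ _ ((p%:R ^+ (11 * n)) `^ (40%:R / 41%:R))); last first.
  apply: ge0_ler_powR.
  - by rewrite divr_ge0 ?ler0n.
  - by rewrite nnegrE exprn_ge0 // ltW.
  - by rewrite nnegrE ler0n.
  - by rewrite -natrX ler_nat.
rewrite -!(powR_mulrn _ (ltW p0)) -powRrM.
apply: ler_powR; first by rewrite ler1n ltnW.
rewrite mulrA ler_pdivlMr ?ltr0n // -!natrM ler_nat.
lia.
Qed.

Theorem theorem1 (R : realType) (p : nat) (p_prime : prime p) :
  (exists (gT : nat -> finGroupType) (U : forall i : nat, {group gT i}),
    [/\ forall i : nat, p.-group (U i),
        #|U i| @[i --> \oo] --> \oo
      & (limn_esup (fun i : nat =>
           (#|Aut (U i)|%:R / (#|U i|%:R `^ (40%:R / 41%:R)) : R)%:E) < +oo)%E])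
  /\
  (exists (gT : finGroupType) (G : {group gT}),
    [/\ p.-group G, ~~ abelian G & (#|Aut G| < #|G|)%N]).
Proof.
have p_gt1 := prime_gt1 p_prime; split.
  exists _, (small_aut_group p); split=> [i||].
  - by have [] := small_aut_group_spec p_prime i.
  - apply/cvgnyPge => A; near=> i.
    have [_ ge_U _ _] := small_aut_group_spec p_prime i.
    apply: leq_trans ge_U; apply: leq_trans (ltnW (ltn_expl _ p_gt1)).
    rewrite (leq_trans (_ : A <= i)%N) ?leq_pmull //.
    by near: i; exact: nbhs_infty_ge.
  - apply: (@le_lt_trans _ _ (aut_const p)%:R%:E); last exact: ltry.
    rewrite limn_esup_lim; apply: lime_le; first exact: is_cvg_esups.
    near=> n; apply: ge_ereal_sup => _ [i /= _ <-]; rewrite lee_fin.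
    have [_ ge_U le_Aut _] := small_aut_group_spec p_prime i.
    exact: aut_ratio_le p_gt1 ge_U le_Aut.
(* with C = aut_const p, the index n = C is large enough since C < p^C *)
pose n := aut_const p; exists _, (small_aut_group p n).
have [pU ge_U le_Aut nabU] := small_aut_group_spec p_prime n; split=> //.
apply: leq_ltn_trans le_Aut _; apply: leq_trans ge_U.
rewrite (mulSn 10) expnD ltn_pmul2r ?expn_gt0 ?prime_gt0 //.
exact: ltn_expl.
Unshelve. all: by end_near.
Qed.
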